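(* Assume $k>1$. Then for all sufficiently small $\varepsilon>0$ the energy surface $M_3:=H^{-1}(H(P_3)+\varepsilon)$ of the double spherical pendulum is homeomorphic to the connected sum $(S^2\times S^5)\#(S^2\times S^5)$ of two copies of $S^2\times S^5$.
   Context: Double spherical pendulum. Let $m_1,m_2,l_1,l_2,g>0$. The configuration space is $Q=S^2\times S^2$, where $S^2\subset\mathbb{R}^3$ is the unit sphere; a point of $Q$ is $(q_1,q_2)$ with $q_i=(x_i,y_i,z_i)$, $|q_i|=1$. The potential is $V(q_1,q_2)=g m_2 l_2(kz_1+z_2)$ with slope $k=\frac{(m_1+m_2)l_1}{m_2l_2}$. The Lagrangian on $TQ$ is $L=\frac12\left(m_1\|l_1\dot q_1\|^2+m_2\|l_1\dot q_1+l_2\dot q_2\|^2\right)-V(q_1,q_2)$. The momenta are $p_1=m_1l_1^2\dot q_1+m_2l_1(l_1\dot q_1+l_2\dot q_2)$ and $p_2=m_2l_2(l_1\dot q_1+l_2\dot q_2)$. The phase space $M=T^*Q$ is identified via this (Legendre) transform with the set of $(p_1,p_2,q_1,q_2)\in(\mathbb{R}^3)^4$ satisfying $q_1\cdot q_1=q_2\cdot q_2=1$ and $q_1\cdot\dot q_1=q_2\cdot\dot q_2=0$, where $\dot q_1=\frac1{l_1}\left(\frac{p_1}{m_1l_1}-\frac{p_2}{m_1l_2}\right)$ and $\dot q_2=\frac1{l_2}\left(\frac{p_2}{m_2l_2}-\frac{p_1}{m_1l_1}+\frac{p_2}{m_1l_2}\right)$. The Hamiltonian on $M$ is $$H(p_1,p_2,q_1,q_2)=\frac12\left(\frac1{m_1}\left\|\frac{p_1}{l_1}-\frac{p_2}{l_2}\right\|^2+\frac1{m_2}\left\|\frac{p_2}{l_2}\right\|^2\right)+V(q_1,q_2).$$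 Let $0=(0,0,-1)$ and $\infty=(0,0,1)$ be the lowest and highest points of $S^2$. The critical points of $V$ on $Q$ are $P_1=(0,0)$, $P_2=(0,\infty)$, $P_3=(\infty,0)$, $P_4=(\infty,\infty)$. The same symbols denote the points of $T^*Q$ with zero momentum over them, so $H(P_i)=V(P_i)$. *)

(* Defs.v *)
From HB Require Import structures.
From mathcomp Require Import all_boot all_order all_algebra generic_quotient.
From mathcomp Require Import all_classical all_reals all_analysis.
From mathcomp Require Import ring.

Set Implicit Arguments.
Unset Strict Implicit.
Unset Printing Implicit Defensive.

Import Order.TTheory GRing.Theory Num.Theory.
Import numFieldNormedType.Exports.

Local Open Scope classical_set_scope.
Local Open Scope ring_scope.
Local Open Scope quotient_scope.

(* The library norm on ['rV[R]_n] is the max-norm, so Euclidean lengths are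
   expressed with [dot]. *)
Definition dot (R : realType) (n : nat) (u v : 'rV[R]_n) : R :=
  \sum_(i < n) u 0 i * v 0 i.

Definition homeomorphic (X Y : topologicalType) : Prop :=
  exists (f : X -> Y) (g : Y -> X),
    [/\ continuous f, continuous g, cancel f g & cancel g f].

Definition unit_sphere (R : realType) (n : nat) : set 'rV[R]_n.+1 :=
  [set x | dot x x = 1].
Arguments unit_sphere R n : clear implicits.

(* An open embedding of the whole R^n: its restriction to the closed unit ball
   is a closed disc with a collar, along which a connected sum can be formed. *)
Record disc_chart (R : realType) (n : nat) (M : topologicalType) := DiscChart {
  chart_map :> 'rV[R]_n -> M;
  chart_continuous : continuous chart_map;
  chart_inj : injective chart_map;
  chart_open : forall U : set 'rV[R]_n, open U -> open (chart_map @` U)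
}.

Section ConnectedSum.
Variables (R : realType) (n : nat) (M : bool -> topologicalType).
Variable e : forall b, disc_chart R n (M b).

Definition complement_disc (b : bool) : set (M b) :=
  ~` (e b @` [set u | dot u u < 1]).
Arguments complement_disc b : clear implicits.

Local Notation complement_disc_union := {b : bool & complement_disc b}.

(* The boundary points [e false u] and [e true u], with [u] on the unit sphere
   of R^n, are identified. *)
Definition glued (x y : complement_disc_union) : Prop :=
  x = y \/ exists u : 'rV[R]_n, [/\ dot u u = 1,
    set_val (projT2 x) = e (projT1 x) u & set_val (projT2 y) = e (projT1 y) u].

Definition gluedb (x y : complement_disc_union) : bool := `[< glued x y >].

Lemma gluedb_refl : reflexive gluedb.
Proof. by move=> x; apply/asboolP; left. Qed.

Lemma gluedb_sym : symmetric gluedb.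
Proof.
suff h x y : glued x y -> glued y x.
  by move=> x y; apply/asbool_equiv_eq; split; exact: h.
by case=> [->|[u [u1 xu yu]]]; [left | right; exists u].
Qed.

Lemma gluedb_trans : transitive gluedb.
Proof.
move=> y x z /asboolP xy /asboolP yz; apply/asboolP.
case: xy => [->//|[u [u1 xu yu]]]; case: yz => [<-|[v [v1 yv zv]]].
  by right; exists u.
right; exists u; split=> //; rewrite zv; congr (e _ _).
by apply: (@chart_inj _ _ _ (e (projT1 y))); rewrite -yv yu.
Qed.

Definition glued_equiv := EquivRel gluedb gluedb_refl gluedb_sym gluedb_trans.

Definition connsum : topologicalType :=
  quotient_topology {eq_quot glued_equiv}.

End ConnectedSum.

(* [X] is homeomorphic to a connected sum of the [n]-manifolds [M] and [N], for
   some choice of the two discs. Orientations play no role when [M] or [N]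
   admits an orientation-reversing homeomorphism, as S^2 x S^5 does; the
   connected sum is then independent of the discs up to homeomorphism. *)
Definition homeomorphic_to_connsum (R : realType) (n : nat)
    (X M N : topologicalType) : Prop :=
  exists e : forall b : bool, disc_chart R n (if b then N else M),
    homeomorphic X (connsum e).

Section DoubleSphericalPendulum.
Variables (R : realType) (m1 m2 l1 l2 g : R).

Local Notation phase := ('rV[R]_3 * 'rV[R]_3 * 'rV[R]_3 * 'rV[R]_3)%type.

Definition north_pole : 'rV[R]_3 := delta_mx 0 ord_max.
Definition south_pole : 'rV[R]_3 := - north_pole.

Definition zcoord (q : 'rV[R]_3) : R := q 0 ord_max.

Definition slope : R := ((m1 + m2) * l1) / (m2 * l2).

Definition potential (q1 q2 : 'rV[R]_3) : R :=
  g * m2 * l2 * (slope * zcoord q1 + zcoord q2).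

(* The velocities in terms of the momenta, i.e. the inverse of the Legendre
   transform p1 = m1 l1^2 q1' + m2 l1 (l1 q1' + l2 q2'),
   p2 = m2 l2 (l1 q1' + l2 q2'); see [legendre1] and [legendre2]. *)
Definition velocity1 (p1 p2 : 'rV[R]_3) : 'rV[R]_3 :=
  l1^-1 *: ((m1 * l1)^-1 *: p1 - (m1 * l2)^-1 *: p2).

Definition velocity2 (p1 p2 : 'rV[R]_3) : 'rV[R]_3 :=
  l2^-1 *: ((m2 * l2)^-1 *: p2 - (m1 * l1)^-1 *: p1 + (m1 * l2)^-1 *: p2).

Lemma legendre1 (p1 p2 : 'rV[R]_3) :
    m1 != 0 -> m2 != 0 -> l1 != 0 -> l2 != 0 ->
  p1 = (m1 * l1 ^+ 2) *: velocity1 p1 p2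
       + (m2 * l1) *: (l1 *: velocity1 p1 p2 + l2 *: velocity2 p1 p2).
Proof.
move=> m1n m2n l1n l2n; apply/rowP => i; rewrite !mxE.
by field; rewrite m1n m2n l1n l2n.
Qed.

Lemma legendre2 (p1 p2 : 'rV[R]_3) :
    m1 != 0 -> m2 != 0 -> l1 != 0 -> l2 != 0 ->
  p2 = (m2 * l2) *: (l1 *: velocity1 p1 p2 + l2 *: velocity2 p1 p2).
Proof.
move=> m1n m2n l1n l2n; apply/rowP => i; rewrite !mxE.
by field; rewrite m1n m2n l1n l2n.
Qed.

(* T^*(S^2 x S^2), as a subspace of R^12. *)
Definition phase_space : set phase :=
  [set w | let: (p1, p2, q1, q2) := w in
    [/\ dot q1 q1 = 1, dot q2 q2 = 1,
        dot q1 (velocity1 p1 p2) = 0 & dot q2 (velocity2 p1 p2) = 0]].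

Definition hamiltonian (w : phase) : R :=
  let: (p1, p2, q1, q2) := w in
  let a := l1^-1 *: p1 - l2^-1 *: p2 in
  let b := l2^-1 *: p2 in
  2^-1 * (m1^-1 * dot a a + m2^-1 * dot b b) + potential q1 q2.

Definition P3 : phase := (0, 0, north_pole, south_pole).

Definition energy_surface (h : R) : set phase :=
  [set w | phase_space w /\ hamiltonian w = h].

End DoubleSphericalPendulum.

(* Main.v *)
(* Rescaling the velocities turns the energy surface into the set of all
   (q1, q2, v1, v2), with v_i tangent to S^2 at q_i, such that
   |v1|^2 + |v2|^2 = al1 (1 - z1) + al2 (1 - z2) - be; for energies between
   H(P3) and H(P4) one has 0 < be < 2 al1 and 0 < be < 2 al2, so that at most
   one q_i is the north pole. In stereographic coordinates x, y of q1, q2 and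
   orthonormal frames a, b of the tangent planes, each ray of R^8 = {(x,y,a,b)}
   meets this set at most once. Hence the part with q1, q2 different from the
   north pole is S^7 minus two circles, and the whole is S^7 surgered along
   them. The two circles are unlinked: they are separated by the 6-sphere
   a_1 - b_1 + sgn(|x|^2 - |y|^2) | |x|^2 - |y|^2 |^(1/2) = 0. On the side where
   q2 is not the north pole, q1 together with the direction of (y, a, b), where
   TS^2 + R is trivialized as R^3, gives an embedding into S^2 x S^5 whose image
   is the complement of an explicit open disc, a star-shaped domain of S^7. The
   other side is its mirror image under the exchange of the two factors. *)
Require Import Defs.
From mathcomp Require Import all_boot all_order all_algebra.
From mathcomp Require Import all_classical all_reals all_analysis.
From mathcomp Require Import ring lra.
From mathcomp Require Import generic_quotient.
Import Order.TTheory GRing.Theory Num.Theory.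
Import numFieldNormedType.Exports.
Local Open Scope classical_set_scope.
Local Open Scope ring_scope.

Set Implicit Arguments.
Unset Strict Implicit.
Unset Printing Implicit Defensive.

(** * Spaces cut along a sphere *)

(** A connected sum is a quotient with prescribed boundary parametrizations, so both halves need
    explicit maps that agree point by point on the cut; homogeneity provides them. The scalars t > 0
    act on R^8 = {(x,y,a,b)}, and a function of degree 1 has constant sign on rays, so it cuts the
    surface without reference to the energy. The signed square root brings |x|^2 - |y|^2 to degree
    1. The linear term a_1 - b_1 makes the zero set a graph over the other seven coordinates, hence
    a sphere whose points are labelled by the unit vectors of R^7. Exchanging the two factors
    changes the sign of the function, so one half suffices. The bounds on be decide which rays meet
    the surface: be < 2 al2 excludes the circle y = a = b = 0, be < 2 al1 the circle x = a = b = 0,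
    and every other ray meets it. Over the north pole of q1 the coordinate x is lost, but (y, v1, b)
    still spans rays, and the energy equation keeps its form without the al1 term. *)

(** Each [f b] embeds the closed half [A b] onto the complement of a disc and may be junk off [A b].
    The two inverses assemble into a map on the disjoint union whose fibres are exactly the gluing
    classes; the last two hypotheses secure this on the common boundary. *)
Lemma homeomorphic_connsum (R : realType) (n : nat) (M : bool -> topologicalType)
    (e : forall b, disc_chart R n (M b)) (X : topologicalType)
    (A : bool -> set X) (f : forall b, X -> M b) :
  compact [set: X] -> (forall b, hausdorff_space (M b)) ->
  (forall b, closed (A b)) -> (forall x, exists b, A b x) ->
  (forall b x, A b x -> {for x, continuous (f b)}) ->
  (forall b x y, A b x -> A b y -> f b x = f b y -> x = y) ->
  (forall b, f b @` A b = complement_disc e (b := b)) ->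
  (forall b x u, A b x -> dot u u = 1 -> f b x = e b u -> A (~~ b) x) ->
  (forall x, (forall b, A b x) ->
     exists u, dot u u = 1 /\ forall b, f b x = e b u) ->
  homeomorphic X (connsum e).
Proof.
move=> cX hM clA covA ctf injf imf bdA matchA.
have imP b z : complement_disc e z -> exists2 x, A b x & f b x = z.
  by rewrite -imf => -[x Ax fx]; exists x.
pose U := {b : bool & complement_disc e (b := b)}.
have Pinv (s : U) : exists x, A (projT1 s) x /\ f (projT1 s) x = set_val (projT2 s).
  case: s => b y /=; have /imP[x Ax fx] := set_valP y.
  by exists x.
pose h (s : U) : X := projT1 (cid (Pinv s)).
have hA s : A (projT1 s) (h s) by have [] := projT2 (cid (Pinv s)).
have hf s : f (projT1 s) (h s) = set_val (projT2 s).
  by have [] := projT2 (cid (Pinv s)).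
have imA b x : A b x -> f b x \in complement_disc e (b := b).
  by move=> Ax; apply/mem_set; rewrite -imf; exists x.
have glueP (s t : U) : glued s t <-> h s = h t.
  split.
    case=> [->//|[u [u1 su tu]]].
    have bdh (r : U) : set_val (projT2 r) = e (projT1 r) u -> forall b, A b (h r).
      move=> ru b; have Ar := hA r; have fr := hf r; rewrite ru in fr.
      have Br := bdA _ _ _ Ar u1 fr.
      by have [->|->] : b = projT1 r \/ b = ~~ projT1 r
        by case: (b) (projT1 r) => -[]; [left|right|right|left].
    (* [matchA] yields some parameter [v]; injectivity of the chart identifies it with [u]. *)
    have hu (r : U) : set_val (projT2 r) = e (projT1 r) u ->
      forall b, f b (h r) = e b u.
      move=> ru; have [v [v1 fv]] := matchA _ (bdh _ ru).
      have /chart_inj-> // : e (projT1 r) u = e (projT1 r) v.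
      by rewrite -fv hf ru.
    by apply: (injf true); [exact: bdh|exact: bdh|rewrite !hu].
  move=> st; case: (eqVneq (projT1 s) (projT1 t)) => bst.
    left; move: s t bst st => [b x] [c y] /= bc; move: y; rewrite -bc {c bc} => y st.
    congr existT; apply: val_inj.
    by have := hf (existT _ b y); have := hf (existT _ b x); rewrite /= st => -> .
  right; have Ah : forall b, A b (h s).
    move=> b; have := hA t; have := hA s; rewrite -st.
    by case: b (projT1 s) (projT1 t) bst => -[] [].
  have [u [u1 fu]] := matchA _ Ah.
  by exists u; rewrite -!hf -st !fu.
have hcont : continuous h.
  suff hc b : continuous (fun y : complement_disc e (b := b) => h (existT _ b y)).
    have -> : h = unstable.sigT_fun (fun b y => h (existT _ b y)).
      by apply/funext => -[].
    exact: sigT_continuous.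
  (* A continuous map from a compact set to a Hausdorff space is closed, so the inverse of [f b] on
     [A b] is continuous. *)
  apply/continuous_closedP => C clC.
  have -> : (fun y => h (existT _ b y)) @^-1` C
      = set_val @^-1` (f b @` (C `&` A b)).
    apply/seteqP; split=> y /=.
      move=> Cy; exists (h (existT _ b y)); last exact: (hf (existT _ b y)).
      by split=> //; exact: (hA (existT _ b y)).
    move=> [x [Cx Ax]] fx.
    suff -> : h (existT _ b y) = x by [].
    apply: (injf b) => //; first exact: (hA (existT _ b y)).
    by rewrite (hf (existT _ b y)).
  apply: preimage_closed; first by move=> ? _; apply: initial_continuous.
  apply: (compact_closed (hM b)); apply: continuous_compact.
    by apply: continuous_in_subspaceT => x /set_mem [_ Ax]; exact: ctf.
  by apply: (subclosed_compact _ cX) => //; exact: closedI.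
pose Q := connsum e.
pose piQ (s : U) : Q := \pi_(quotient_topology {eq_quot glued_equiv e}%qT)%qT s.
have piQE s t : piQ s = piQ t <-> h s = h t.
  rewrite -glueP; split=> [/(@eqmodP _ (glued_equiv e)) /asboolP //|st].
  by apply/(@eqmodP _ (glued_equiv e)); apply/asboolP.
pose G (q : Q) : X := h (repr (q : quotient_topology {eq_quot glued_equiv e}%qT)).
have Gpi s : G (piQ s) = h s.
  by apply/piQE; rewrite /piQ reprK.
have piQ_surj q : exists s, q = piQ s.
  by exists (repr (q : quotient_topology {eq_quot glued_equiv e}%qT));
    rewrite /piQ reprK.
have [sec secP] := choice covA.
pose s_of b x (Ax : A b x) : U := existT _ b (exist _ (f b x) (imA b x Ax)).
have hs_of b x Ax : h (s_of b x Ax) = x.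
  apply: (injf b) => //; first exact: (hA (s_of b x Ax)).
  by rewrite (hf (s_of b x Ax)).
pose F x : Q := piQ (s_of _ x (secP x)).
have FE b x (Ax : A b x) : F x = piQ (s_of b x Ax) by apply/piQE; rewrite !hs_of.
exists F, G; split.
- apply/continuous_closedP => C clC.
  (* A closed set of the subspace is the trace of a closed [D] of [M b], so membership in [C] can be
     tested through [f b]. *)
  have clCb b : exists2 D : set (M b), closed D & forall x (Ax :
    A b x), C (F x) <-> D (f b x).
    have : closed ((fun y => piQ (existT _ b y)) @^-1` C).
      apply: preimage_closed => // y _.
      apply: (@continuous_comp _ _ _ (fun y => existT _ b y) piQ).
        exact: existT_continuous.
      exact: pi_continuous.
    rewrite -openC => -[V oV VE]; exists (~` V); first by rewrite closedC.
    move=> x Ax; rewrite (FE _ _ Ax).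
    have VC : V (f b x) = (~ C (piQ (s_of b x Ax))).
      exact: (congr1 (fun S => S (exist _ (f b x) (imA b x Ax))) VE).
    split=> [Cx Vx|nV]; first by move: (Vx); rewrite VC; apply.
    by apply: contrapT => nC; apply: nV; rewrite VC.
  have -> : F @^-1` C = \bigcup_(b in [set: bool]) (A b `&` F @^-1` C).
    apply/seteqP; split=> x /=; last by case=> b _ [].
    by move=> Cx; have [b Ab] := covA x; exists b.
  apply: closed_bigcup => //; first exact: finite_finset.
  move=> b _; have [D clD DE] := clCb b.
  (* Continuity of [f b] is known only at points of [A b]; at the other points the complement of the
     closed set [A b] is already a neighbourhood. *)
  rewrite -openC openE => x /= nx.
  have [Ax|nAx] := pselect (A b x); last first.
    have : nbhs x (~` A b) by apply: open_nbhs_nbhs; split=> //; rewrite openC.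
    by apply: filterS => y nAy [].
  have nD : ~ D (f b x) by move=> /DE -/(_ Ax) Cx; apply: nx.
  have : nbhs x (f b @^-1` (~` D)).
    by apply: (ctf _ _ Ax); apply: open_nbhs_nbhs; split=> //; rewrite openC.
  by apply: filterS => y nDy [Ay /(DE _ Ay)].
- apply/quotient_continuous.
  rewrite (_ : _ \o _ = h) //; apply/funext => s; exact: Gpi.
- by move=> x; rewrite /F Gpi hs_of.
- by move=> q; have [s ->] := piQ_surj q; rewrite Gpi; apply/piQE; rewrite hs_of.
Qed.

(** * Row vectors by entries *)

(** Indices in [nat] let vectors be given by sequences and their entries be computed. Out of range,
    [inord] falls back to index 0, so bounds over all [k] are harmless. *)
Definition entry (R : realType) (n : nat) (v : 'rV[R]_n.+1) (k : nat) : R :=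
  v 0 (inord k).

Definition row_of (R : realType) (n : nat) (s : seq R) : 'rV[R]_n.+1 :=
  \row_i nth 0 s i.

Arguments entry {R n} v k.
Arguments row_of {R} n s.

Lemma entry_row_of (R : realType) (n : nat) (s : seq R) (k : nat) :
  (k <= n)%N -> entry (row_of n s) k = nth 0 s k.
Proof. by move=> kn; rewrite /entry /row_of mxE inordK. Qed.

Lemma entry_ext (R : realType) (n : nat) (v w : 'rV[R]_n.+1) :
  (forall k, (k <= n)%N -> entry v k = entry w k) -> v = w.
Proof.
move=> vw; apply/rowP => i; have := vw i; rewrite /entry inord_val; apply.
by rewrite -ltnS.
Qed.

Lemma entryZ (R : realType) (n : nat) (c : R) (v : 'rV[R]_n.+1) k :
  entry (c *: v) k = c * entry v k.
Proof. by rewrite /entry mxE. Qed.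

Lemma entry0 (R : realType) (n : nat) k : entry (0 : 'rV[R]_n.+1) k = 0.
Proof. by rewrite /entry mxE. Qed.

Lemma dot_entry (R : realType) (n : nat) (u v : 'rV[R]_n.+1) :
  dot u v = \sum_(0 <= k < n.+1) entry u k * entry v k.
Proof.
rewrite big_mkord /dot; apply: eq_bigr => i _.
by rewrite /entry inord_val.
Qed.

Lemma dot3E (R : realType) (u v : 'rV[R]_3) :
  dot u v = entry u 0 * entry v 0 + entry u 1 * entry v 1 + entry u 2 * entry v 2.
Proof. by rewrite dot_entry !big_nat_recr //= big_geq // add0r. Qed.

Lemma dot6E (R : realType) (u v : 'rV[R]_6) :
  dot u v = entry u 0 * entry v 0 + entry u 1 * entry v 1 + entry u 2 * entry v 2
          + entry u 3 * entry v 3 + entry u 4 * entry v 4 + entry u 5 * entry v 5.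
Proof. by rewrite dot_entry !big_nat_recr //= big_geq // add0r. Qed.

Lemma dot7E (R : realType) (u v : 'rV[R]_7) :
  dot u v = entry u 0 * entry v 0 + entry u 1 * entry v 1 + entry u 2 * entry v 2
          + entry u 3 * entry v 3 + entry u 4 * entry v 4 + entry u 5 * entry v 5
          + entry u 6 * entry v 6.
Proof. by rewrite dot_entry !big_nat_recr //= big_geq // add0r. Qed.

Lemma zcoordE (R : realType) (q : 'rV[R]_3) : zcoord q = entry q 2.
Proof. by rewrite /zcoord /entry; congr (q 0 _); apply: val_inj; rewrite /= inordK. Qed.

Lemma entry_ext3 (R : realType) (u v : 'rV[R]_3) :
  entry u 0 = entry v 0 -> entry u 1 = entry v 1 -> entry u 2 = entry v 2 -> u = v.
Proof. by move=> *; apply: entry_ext => -[|[|[|]]]. Qed.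

Lemma dot_ge0 (R : realType) n (u : 'rV[R]_n) : 0 <= dot u u.
Proof. by apply: sumr_ge0 => i _; rewrite -expr2 sqr_ge0. Qed.

Lemma dot_eq0 (R : realType) n (u : 'rV[R]_n) : dot u u = 0 -> u = 0.
Proof.
move=> /eqP; rewrite psumr_eq0; last by move=> i _; rewrite -expr2 sqr_ge0.
move=> /allP u0; apply/rowP => i; rewrite mxE; apply/eqP.
by have := u0 i (mem_index_enum _); rewrite /= mulf_eq0 orbb.
Qed.

(* A definition, not a notation, so that the tactic [cont] can match on it. *)
Definition cont_at (T U : topologicalType) (x : T) (f : T -> U) : Prop :=
  f @ x --> f x.

Lemma cont_at_comp (T U V : topologicalType) (x : T) (f : T -> U) (g : U -> V) :
  cont_at x f -> cont_at (f x) g -> cont_at x (fun t => g (f t)).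
Proof. by move=> cf cg; exact: (cvg_comp _ _ cf). Qed.

(** * Continuity at a point *)

Section ContinuityAtPoint.
Context {R : realType} {T : topologicalType} (x : T).

Lemma cont_at_cst (U : topologicalType) (c : U) : cont_at x (fun=> c).
Proof. exact: cvg_cst. Qed.

Lemma cont_at_id : cont_at x (fun t => t).
Proof. exact: cvg_id. Qed.

Lemma cont_at_fst (U V : topologicalType) (f : T -> U * V) :
  cont_at x f -> cont_at x (fun t => (f t).1).
Proof. by move=> cf; apply: (cont_at_comp (g := fst) cf); exact: cvg_fst. Qed.

Lemma cont_at_snd (U V : topologicalType) (f : T -> U * V) :
  cont_at x f -> cont_at x (fun t => (f t).2).
Proof. by move=> cf; apply: (cont_at_comp (g := snd) cf); exact: cvg_snd. Qed.

Lemma cont_at_pair (U V : topologicalType) (f : T -> U) (g : T -> V) :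
  cont_at x f -> cont_at x g -> cont_at x (fun t => (f t, g t)).
Proof. by move=> cf cg; exact: cvg_pair. Qed.

Lemma cont_at_entry n k (f : T -> 'rV[R]_n.+1) :
  cont_at x f -> cont_at x (fun t => entry (f t) k).
Proof.
move=> cf; apply: (cont_at_comp (g := fun v => entry v k) cf).
exact: coord_continuous.
 Qed.

Lemma cont_at_row n (f : T -> 'rV[R]_n.+1) :
  (forall k, (k <= n)%N -> cont_at x (fun t => entry (f t) k)) -> cont_at x f.
Proof.
move=> cf S [P nP PS]; have nf : \forall t \near x, forall j, P 0 j (f t 0 j).
  apply: filter_forall => j.
  have := cf j (ltn_ord j : (j <= n)%N) (P 0 j); rewrite /entry inord_val.
  by apply; exact: nP.
apply: filterS nf => t Pt; apply: PS => i j; rewrite ord1; exact: Pt.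
Qed.

Lemma cont_at_row_of n (s : T -> seq R) :
  (forall k, (k <= n)%N -> cont_at x (fun t => nth 0 (s t) k)) ->
  cont_at x (fun t => row_of n (s t)).
Proof.
move=> cs; apply: cont_at_row => k kn.
rewrite (_ : (fun t => _) = (fun t => nth 0 (s t) k)); first exact: cs.
by apply/funext => t; rewrite entry_row_of.
Qed.

Implicit Types f g : T -> R.

Lemma cont_atD f g : cont_at x f -> cont_at x g ->
  cont_at x (fun t => f t + g t).
Proof. by move=> cf cg; apply: (@cvgD _ R^o). Qed.

Lemma cont_atN f : cont_at x f -> cont_at x (fun t => - f t).
Proof. by move=> cf; apply: (@cvgN _ R^o). Qed.

Lemma cont_atM f g : cont_at x f -> cont_at x g ->
  cont_at x (fun t => f t * g t).
Proof. by move=> cf cg; apply: cvgM. Qed.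

Lemma cont_atX n f : cont_at x f -> cont_at x (fun t => f t ^+ n).
Proof.
move=> cf; elim: n => [|n IHn]; first exact: cont_at_cst.
rewrite (_ : (fun t => f t ^+ n.+1) = (fun t => f t * f t ^+ n)).
  exact: cont_atM.
by apply/funext => t; rewrite exprS.
Qed.

Lemma cont_atV f : f x != 0 -> cont_at x f -> cont_at x (fun t => (f t)^-1).
Proof. by move=> fx cf; apply: cvgV. Qed.

Lemma cont_at_sqrt f : cont_at x f -> cont_at x (fun t => Num.sqrt (f t)).
Proof.
move=> cf; apply: (cont_at_comp (g := Num.sqrt) cf).
exact: sqrt_continuous.
 Qed.

End ContinuityAtPoint.

Lemma cont_at_dot (R : realType) (T : topologicalType) (x : T) n
    (f g : T -> 'rV[R]_n.+1) :
  cont_at x f -> cont_at x g -> cont_at x (fun t => dot (f t) (g t)).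
Proof.
move=> cf cg; under eq_fun do rewrite dot_entry.
suff H k : cont_at x (fun t => \sum_(0 <= i < k) entry (f t) i * entry (g t) i).
  exact: H.
elim: k => [|k IHk].
  by under eq_fun do rewrite big_geq//; exact: cont_at_cst.
rewrite (_ : (fun t => _) = (fun t =>
    \sum_(0 <= i < k) entry (f t) i * entry (g t) i + entry (f t) k * entry (g t) k)).
  by apply: cont_atD => //; apply: cont_atM; exact: cont_at_entry.
by apply/funext => t; rewrite big_nat_recr.
Qed.

(** The nonvanishing condition of an inverse is left to [assumption] in [cont], so it has to be in
    the context beforehand. *)
Ltac cont_step :=
  lazymatch goal with
  | |- cont_at _ (fun t => t) => apply: cont_at_id
  | |- cont_at _ fst => exact: cvg_fst
  | |- cont_at _ snd => exact: cvg_snd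
  | |- cont_at _ (fun _ => ?c) => apply: cont_at_cst
  | |- cont_at _ (fun t => @?f t + @?g t) => apply: cont_atD
  | |- cont_at _ (fun t => - @?f t) => apply: cont_atN
  | |- cont_at _ (fun t => @?f t * @?g t) => apply: cont_atM
  | |- cont_at _ (fun t => @?f t ^+ _) => apply: cont_atX
  | |- cont_at _ (fun t => (@?f t)^-1) => apply: cont_atV
  | |- cont_at _ (fun t => Num.sqrt (@?f t)) => apply: cont_at_sqrt
  | |- cont_at _ (fun t => dot (@?f t) (@?g t)) => apply: cont_at_dot
  | |- cont_at _ (fun t => entry (@?f t) _) => apply: cont_at_entry
  | |- cont_at _ (fun t => (@?f t).1) => apply: cont_at_fst
  | |- cont_at _ (fun t => (@?f t).2) => apply: cont_at_snd
  | |- cont_at _ (fun t => (@?f t, @?g t)) => apply: cont_at_pair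
  end.

Ltac cont := repeat (first [assumption | cont_step]).

(** * Stereographic coordinates and rotated frames *)

Section Stereographic.
Context {R : realType}.
Implicit Types (q v : 'rV[R]_3) (x a r : R).

(* [stereo] is the inverse of the stereographic projection from the north pole,
   and [frame x0 x1] the rotation of R^3 carrying the south pole to
   [stereo x0 x1] along the meridian, restricted to the plane z = 0. *)
Definition stereo_coord q k : R := entry q k / (1 - entry q 2).
Definition frame_coord q v k : R := entry v k + entry v 2 * stereo_coord q k.

Definition stereo x0 x1 : 'rV[R]_3 :=
  let D := x0 ^+ 2 + x1 ^+ 2 + 1 in
  row_of 2 [:: 2 * x0 / D; 2 * x1 / D; (D - 2) / D].

Definition frame x0 x1 a0 a1 : 'rV[R]_3 :=
  let D := x0 ^+ 2 + x1 ^+ 2 + 1 in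
  let s := x0 * a0 + x1 * a1 in
  row_of 2 [:: a0 - 2 * s * x0 / D; a1 - 2 * s * x1 / D; 2 * s / D].

(* The dilation x |-> x / r in stereographic coordinates, cleared of the
   denominators that vanish at the north pole; [dilate_vec] rotates tangent
   vectors along the meridian from q to [dilate r q]. *)
Definition dilate_den r q : R := (1 + entry q 2) + r ^+ 2 * (1 - entry q 2).

Definition dilate r q : 'rV[R]_3 :=
  let d := dilate_den r q in
  row_of 2 [:: 2 * r * entry q 0 / d; 2 * r * entry q 1 / d;
           ((1 + entry q 2) - r ^+ 2 * (1 - entry q 2)) / d].

Definition dilate_vec r q v : 'rV[R]_3 :=
  let d := dilate_den r q in
  row_of 2 [:: entry v 0 + entry v 2 * (r ^+ 2 - 1) / d * entry q 0;
           entry v 1 + entry v 2 * (r ^+ 2 - 1) / d * entry q 1;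
           2 * r * entry v 2 / d].

Lemma stereo_den_gt0 x0 x1 : 0 < x0 ^+ 2 + x1 ^+ 2 + 1.
Proof. by have := sqr_ge0 x0; have := sqr_ge0 x1; lra. Qed.

Lemma unit_z_bounds q : dot q q = 1 -> -1 <= entry q 2 <= 1.
Proof.
rewrite dot3E -!expr2 => q1; have := sqr_ge0 (entry q 0); have := sqr_ge0 (entry q 1).
by move=> ? ?; apply/andP; split; nra.
Qed.

Lemma unit_z1 q : dot q q = 1 -> entry q 2 = 1 -> entry q 0 = 0 /\ entry q 1 = 0.
Proof.
rewrite dot3E -!expr2 => q1 z1; rewrite z1 in q1.
have := sqr_ge0 (entry q 0); have := sqr_ge0 (entry q 1) => ? ?.
by split; apply/eqP; rewrite -sqrf_eq0; apply/eqP; lra.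
Qed.

Lemma dilate_den_gt0 r q : dot q q = 1 -> 0 < r -> 0 < dilate_den r q.
Proof.
move=> /unit_z_bounds /andP[z1 z2] r0; rewrite /dilate_den.
have r2 : 0 < r ^+ 2 by rewrite exprn_gt0.
by have [->|/eqP z] := eqVneq (entry q 2) 1; nra.
Qed.

Lemma stereo_unit x0 x1 : dot (stereo x0 x1) (stereo x0 x1) = 1.
Proof.
have D0 := lt0r_neq0 (stereo_den_gt0 x0 x1).
by rewrite dot3E !entry_row_of //=; field.
Qed.

Lemma stereo_z x0 x1 : 1 - entry (stereo x0 x1) 2 = 2 / (x0 ^+ 2 + x1 ^+ 2 + 1).
Proof.
have D0 := lt0r_neq0 (stereo_den_gt0 x0 x1).
by rewrite !entry_row_of //=; field.
Qed.

Lemma stereo_z_neq1 x0 x1 : 1 - entry (stereo x0 x1) 2 != 0.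
Proof. by rewrite stereo_z lt0r_neq0 // divr_gt0 // stereo_den_gt0. Qed.

Lemma frame_perp x0 x1 a0 a1 : dot (stereo x0 x1) (frame x0 x1 a0 a1) = 0.
Proof.
have D0 := lt0r_neq0 (stereo_den_gt0 x0 x1).
by rewrite dot3E !entry_row_of //=; field.
Qed.

Lemma frame_norm x0 x1 a0 a1 :
  dot (frame x0 x1 a0 a1) (frame x0 x1 a0 a1) = a0 ^+ 2 + a1 ^+ 2.
Proof.
have D0 := lt0r_neq0 (stereo_den_gt0 x0 x1).
by rewrite dot3E !entry_row_of //=; field.
Qed.

Lemma stereo_coord_stereo x0 x1 :
  stereo_coord (stereo x0 x1) 0 = x0 /\ stereo_coord (stereo x0 x1) 1 = x1.
Proof.
have D0 := lt0r_neq0 (stereo_den_gt0 x0 x1).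
by rewrite /stereo_coord stereo_z !entry_row_of //=; split; field.
Qed.

Lemma frame_coord_frame x0 x1 a0 a1 :
  let q := stereo x0 x1 in let v := frame x0 x1 a0 a1 in
  frame_coord q v 0 = a0 /\ frame_coord q v 1 = a1.
Proof.
have D0 := lt0r_neq0 (stereo_den_gt0 x0 x1).
rewrite /frame_coord /=; have [-> ->] := stereo_coord_stereo x0 x1.
by rewrite !entry_row_of //=; split; field.
Qed.

Lemma stereo_coord_norm q : dot q q = 1 -> 1 - entry q 2 != 0 ->
  stereo_coord q 0 ^+ 2 + stereo_coord q 1 ^+ 2 + 1 = 2 / (1 - entry q 2).
Proof.
rewrite dot3E => q1 z1; rewrite /stereo_coord.
have q01 : entry q 0 ^+ 2 = 1 - entry q 1 ^+ 2 - entry q 2 ^+ 2 by rewrite -q1; ring.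
by rewrite !expr_div_n q01; field.
Qed.

Lemma stereo_stereo_coord q : dot q q = 1 -> 1 - entry q 2 != 0 ->
  stereo (stereo_coord q 0) (stereo_coord q 1) = q.
Proof.
move=> q1 z1; rewrite /stereo stereo_coord_norm //.
by apply: entry_ext3; rewrite !entry_row_of //= /stereo_coord; field; rewrite z1.
Qed.

Lemma stereo_frame_coord q v : dot q v = 0 -> 1 - entry q 2 != 0 -> dot q q = 1 ->
  stereo_coord q 0 * frame_coord q v 0 + stereo_coord q 1 * frame_coord q v 1
    = entry v 2 / (1 - entry q 2).
Proof.
move=> qv z1 q1; rewrite /frame_coord.
have -> : stereo_coord q 0 * (entry v 0 + entry v 2 * stereo_coord q 0) +
    stereo_coord q 1 * (entry v 1 + entry v 2 * stereo_coord q 1)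
  = (dot q v - entry q 2 * entry v 2) / (1 - entry q 2)
    + entry v 2 * (stereo_coord q 0 ^+ 2 + stereo_coord q 1 ^+ 2 + 1) - entry v 2.
  by rewrite dot3E /stereo_coord; field.
by rewrite stereo_coord_norm // qv; field.
Qed.

Lemma frame_frame_coord q v : dot q q = 1 -> 1 - entry q 2 != 0 -> dot q v = 0 ->
  frame (stereo_coord q 0) (stereo_coord q 1) (frame_coord q v 0) (frame_coord q v 1)
    = v.
Proof.
move=> q1 z1 qv; rewrite /frame stereo_coord_norm // stereo_frame_coord //.
by apply: entry_ext3; rewrite !entry_row_of //= /frame_coord /stereo_coord; field;
  rewrite z1.
Qed.

Lemma frame_coord_norm q v : dot q q = 1 -> 1 - entry q 2 != 0 -> dot q v = 0 ->
  frame_coord q v 0 ^+ 2 + frame_coord q v 1 ^+ 2 = dot v v.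
Proof. by move=> q1 z1 qv; rewrite -[in RHS](frame_frame_coord q1 z1 qv) frame_norm.
  Qed.

Lemma dilate_unit r q : dot q q = 1 -> 0 < r -> dot (dilate r q) (dilate r q) = 1.
Proof.
move=> q1 r0; have d0 := lt0r_neq0 (dilate_den_gt0 q1 r0).
move: d0 q1; rewrite /dilate !dot3E !entry_row_of //= /dilate_den => d0 q1.
have q01 : entry q 0 ^+ 2 = 1 - entry q 1 ^+ 2 - entry q 2 ^+ 2 by rewrite -q1; ring.
by field: q01; rewrite d0.
Qed.

Lemma dilate_z r q : dot q q = 1 -> 0 < r ->
  1 - entry (dilate r q) 2 = 2 * r ^+ 2 * (1 - entry q 2) / dilate_den r q.
Proof.
move=> q1 r0; have := lt0r_neq0 (dilate_den_gt0 q1 r0).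
by rewrite /dilate !entry_row_of //= /dilate_den => d0; field; rewrite d0.
Qed.

Lemma dilate_z_eq1 r q : dot q q = 1 -> 0 < r ->
  (1 - entry (dilate r q) 2 == 0) = (1 - entry q 2 == 0).
Proof.
move=> q1 r0; rewrite dilate_z //.
rewrite mulf_eq0 invr_eq0 (negPf (lt0r_neq0 (dilate_den_gt0 q1 r0))) orbF.
by rewrite mulf_eq0 mulf_eq0 sqrf_eq0 (gt_eqF r0) pnatr_eq0 /=.
Qed.

Lemma dilate_vec_perp r q v : dot q q = 1 -> 0 < r -> dot q v = 0 ->
  dot (dilate r q) (dilate_vec r q v) = 0.
Proof.
move=> q1 r0 qv; have := lt0r_neq0 (dilate_den_gt0 q1 r0).
move: q1 qv; rewrite /dilate /dilate_vec !dot3E !entry_row_of //= /dilate_den =>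
  q1 qv d0.
have q01 : entry q 0 ^+ 2 + entry q 1 ^+ 2 = 1 - entry q 2 ^+ 2 by rewrite -q1; ring.
have qv0 : entry q 0 * entry v 0 + entry q 1 * entry v 1 = - (entry q 2 * entry v 2).
  by rewrite -[RHS]add0r -qv; ring.
set d := _ + _ in d0 *.
(* The entries are collected into the combinations that unit length and tangency express through the
   third entries. *)
transitivity (2 * r / d * (entry q 0 * entry v 0 + entry q 1 * entry v 1
  + entry v 2 * (r ^+ 2 - 1) / d * (entry q 0 ^+ 2 + entry q 1 ^+ 2)
  + ((1 + entry q 2) - r ^+ 2 * (1 - entry q 2)) / d * entry v 2)).
  by field; rewrite d0.
by rewrite q01 qv0 /d; field; rewrite d0.
Qed.

Lemma dilate_vec_norm r q v : dot q q = 1 -> 0 < r -> dot q v = 0 ->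
  dot (dilate_vec r q v) (dilate_vec r q v) = dot v v.
Proof.
move=> q1 r0 qv; have := lt0r_neq0 (dilate_den_gt0 q1 r0).
move: q1 qv; rewrite /dilate /dilate_vec !dot3E !entry_row_of //= /dilate_den =>
  q1 qv d0.
have q01 : entry q 0 ^+ 2 + entry q 1 ^+ 2 = 1 - entry q 2 ^+ 2 by rewrite -q1; ring.
have qv0 : entry q 0 * entry v 0 + entry q 1 * entry v 1 = - (entry q 2 * entry v 2).
  by rewrite -[RHS]add0r -qv; ring.
set d := _ + _ in d0 *.
transitivity (entry v 0 ^+ 2 + entry v 1 ^+ 2
  + 2 * entry v 2 * (r ^+ 2 - 1) / d * (entry q 0 * entry v 0 + entry q 1 * entry v 1)
  + (entry v 2 * (r ^+ 2 - 1) / d) ^+ 2 * (entry q 0 ^+ 2 + entry q 1 ^+ 2)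
  + (2 * r * entry v 2 / d) ^+ 2).
  by field; rewrite d0.
by rewrite q01 qv0 /d; field; rewrite d0.
Qed.

Lemma stereo_coord_dilate r q : dot q q = 1 -> 0 < r -> 1 - entry q 2 != 0 ->
  stereo_coord (dilate r q) 0 = stereo_coord q 0 / r /\ stereo_coord (dilate r q) 1
    = stereo_coord q 1 / r.
Proof.
move=> q1 r0 z1; have d0 := lt0r_neq0 (dilate_den_gt0 q1 r0).
have rn0 := lt0r_neq0 r0.
rewrite /stereo_coord dilate_z // /dilate !entry_row_of //=.
by split; field; rewrite rn0 z1 d0.
Qed.

(** The frame and [dilate_vec] rotate along the same meridian, so the two rotations compose to the
    one that defines the frame at the dilated point. *)
Lemma frame_coord_dilate r q v : dot q q = 1 -> 0 < r -> 1 - entry q 2 != 0 ->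
  frame_coord (dilate r q) (dilate_vec r q v) 0 = frame_coord q v 0 /\
  frame_coord (dilate r q) (dilate_vec r q v) 1 = frame_coord q v 1.
Proof.
move=> q1 r0 z1; have := lt0r_neq0 (dilate_den_gt0 q1 r0).
have rn0 := lt0r_neq0 r0.
rewrite /frame_coord; have [-> ->] := stereo_coord_dilate q1 r0 z1.
rewrite /stereo_coord /dilate_vec !entry_row_of //= /dilate_den => d0.
by split; field; rewrite rn0 z1 d0.
Qed.

Lemma dilate1 q : dilate 1 q = q.
Proof.
have d2 : dilate_den 1 q = 2 by rewrite /dilate_den; ring.
by apply: entry_ext3; rewrite /dilate d2 !entry_row_of //=; field.
Qed.

Lemma dilate_vec1 q v : dilate_vec 1 q v = v.
Proof.
have d2 : dilate_den 1 q = 2 by rewrite /dilate_den; ring.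
by apply: entry_ext3; rewrite /dilate_vec d2 !entry_row_of //=; field.
Qed.

End Stereographic.

(** * The map to S^2 x S^5 *)

Section PhaseCharts.
Context {R : realType}.
Local Notation phase := ('rV[R]_3 * 'rV[R]_3 * 'rV[R]_3 * 'rV[R]_3)%type.
Implicit Types (m : phase) (p : 'rV[R]_8) (s : 'rV[R]_3 * 'rV[R]_6).

Definition tangent m : Prop :=
  [/\ dot m.1.1.1 m.1.1.1 = 1, dot m.1.1.2 m.1.1.2 = 1,
      dot m.1.1.1 m.1.2 = 0 & dot m.1.1.2 m.2 = 0].

(* The entries of a vector of R^8 are x (0,1), y (2,3), a (4,5), b (6,7). *)
Definition of_coords p : phase :=
  (stereo (entry p 0) (entry p 1), stereo (entry p 2) (entry p 3),
   frame (entry p 0) (entry p 1) (entry p 4) (entry p 5),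
   frame (entry p 2) (entry p 3) (entry p 6) (entry p 7)).

Definition to_coords m : 'rV[R]_8 :=
  row_of 7 [:: stereo_coord m.1.1.1 0; stereo_coord m.1.1.1 1;
    stereo_coord m.1.1.2 0; stereo_coord m.1.1.2 1;
           frame_coord m.1.1.1 m.1.2 0; frame_coord m.1.1.1 m.1.2 1;
           frame_coord m.1.1.2 m.2 0; frame_coord m.1.1.2 m.2 1].

(** The norm of (y, a, b). Since frames are orthonormal, |a|^2 is written as the squared length of
    the tangent vector, which also makes sense when q1 is the north pole. *)
Definition rho m : R :=
  Num.sqrt (stereo_coord m.1.1.2 0 ^+ 2 + stereo_coord m.1.1.2 1 ^+ 2
            + dot m.1.2 m.1.2 + dot m.2 m.2).

(* The dilation makes [Phi] invariant under rays of R^8, see [Phi_of_coordsZ].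
   The first component of b is carried along the normal vector q, which
   trivializes TS^2 + R. *)
Definition Phi m : 'rV[R]_3 * 'rV[R]_6 :=
  let r := rho m in
  let q := dilate r m.1.1.1 in
  let v := dilate_vec r m.1.1.1 m.1.2 in
  let b k := frame_coord m.1.1.2 m.2 k in
  (q, row_of 5 [:: stereo_coord m.1.1.2 0 / r; stereo_coord m.1.1.2 1 / r;
               (entry v 0 + b 0%N * entry q 0) / r;
               (entry v 1 + b 0%N * entry q 1) / r;
               (entry v 2 + b 0%N * entry q 2) / r; b 1%N / r]).

Definition unPhi_normal s : R :=
  entry s.2 2 * entry s.1 0 + entry s.2 3 * entry s.1 1 + entry s.2 4 * entry s.1 2.

Definition unPhi_tangent s : 'rV[R]_3 :=
  row_of 2 [:: entry s.2 2 - unPhi_normal s * entry s.1 0;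
           entry s.2 3 - unPhi_normal s * entry s.1 1;
           entry s.2 4 - unPhi_normal s * entry s.1 2].

(** Inverse of [Phi] up to scaling: the representative with [coords_rho] equal to 1 on the ray. The
    R^3 part of the second factor is split into its components normal and tangent to S^2. *)
Definition unPhi s : 'rV[R]_8 :=
  row_of 7 [:: stereo_coord s.1 0; stereo_coord s.1 1; entry s.2 0; entry s.2 1;
           frame_coord s.1 (unPhi_tangent s) 0; frame_coord s.1 (unPhi_tangent s) 1;
           unPhi_normal s; entry s.2 5].

Definition sphere_pair s : Prop := dot s.1 s.1 = 1 /\ dot s.2 s.2 = 1.

Definition coords_rho p : R :=
  Num.sqrt (entry p 2 ^+ 2 + entry p 3 ^+ 2 + (entry p 4 ^+ 2 + entry p 5 ^+ 2)
            + (entry p 6 ^+ 2 + entry p 7 ^+ 2)).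

Lemma of_coords_tangent p : tangent (of_coords p).
Proof. by split; rewrite /= ?stereo_unit ?frame_perp. Qed.

Lemma of_coords_z1 p : 1 - entry (of_coords p).1.1.1 2 != 0.
Proof. exact: stereo_z_neq1. Qed.

Lemma of_coords_z2 p : 1 - entry (of_coords p).1.1.2 2 != 0.
Proof. exact: stereo_z_neq1. Qed.

Lemma of_coordsK p : to_coords (of_coords p) = p.
Proof.
rewrite /to_coords /of_coords /=.
have [-> ->] := stereo_coord_stereo (entry p 0) (entry p 1).
have [-> ->] := stereo_coord_stereo (entry p 2) (entry p 3).
have [-> ->] := frame_coord_frame (entry p 0) (entry p 1) (entry p 4) (entry p 5).
have [-> ->] := frame_coord_frame (entry p 2) (entry p 3) (entry p 6) (entry p 7).
by apply: entry_ext => -[|[|[|[|[|[|[|[|]]]]]]]] // _; rewrite entry_row_of.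
Qed.

Lemma to_coordsK m : tangent m -> 1 - entry m.1.1.1 2 != 0 ->
  1 - entry m.1.1.2 2 != 0 ->
  of_coords (to_coords m) = m.
Proof.
case: m => [[[q1 q2] v1] v2] [/= q11 q21 qv1 qv2] z1 z2.
by rewrite /of_coords /to_coords /= !entry_row_of //= !stereo_stereo_coord //
  !frame_frame_coord.
Qed.

Lemma rho_of_coords p : rho (of_coords p) = coords_rho p.
Proof.
rewrite /rho /coords_rho /= !frame_norm.
by have [-> ->] := stereo_coord_stereo (entry p 2) (entry p 3).
Qed.

Lemma rho_sqr m : rho m ^+ 2 = stereo_coord m.1.1.2 0 ^+ 2 + stereo_coord m.1.1.2 1 ^+ 2
  + dot m.1.2 m.1.2 + dot m.2 m.2.
Proof. by rewrite sqr_sqrtr // !addr_ge0 ?sqr_ge0 ?dot_ge0. Qed.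

Lemma Phi_sphere m : tangent m -> 1 - entry m.1.1.2 2 != 0 -> 0 < rho m ->
  sphere_pair (Phi m).
Proof.
move=> [q11 q21 qv1 qv2] z2 r0; split; first exact: dilate_unit.
have rE := rho_sqr m; have rn0 := lt0r_neq0 r0.
have bE := frame_coord_norm q21 z2 qv2.
move: rE (dilate_unit q11 r0) (dilate_vec_perp q11 r0 qv1) (dilate_vec_norm q11 r0 qv1).
rewrite /Phi /=; move: (rho m) rn0 => r rn0.
move: (dilate r _) (dilate_vec r _ _) => q v rE; rewrite !dot3E => qq qv vE.
rewrite dot6E !entry_row_of //=; move: bE.
set b0 := frame_coord _ _ 0; set b1 := frame_coord _ _ 1 => bE.
(* Expansion of |v + b_1 q|^2; the cross term vanishes by tangency and q has length 1. *)
transitivity ((stereo_coord m.1.1.2 0 ^+ 2 + stereo_coord m.1.1.2 1 ^+ 2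
   + (entry v 0 * entry v 0 + entry v 1 * entry v 1 + entry v 2 * entry v 2)
   + 2 * b0 * (entry q 0 * entry v 0 + entry q 1 * entry v 1 + entry q 2 * entry v 2)
   + b0 ^+ 2 * (entry q 0 * entry q 0 + entry q 1 * entry q 1 + entry q 2 * entry q 2)
   + b1 ^+ 2) / r ^+ 2).
  by field.
rewrite qq qv vE mulr0 addr0 mulr1 -addrA bE.
by move: rE; rewrite dot3E => <-; rewrite divff // sqrf_eq0.
Qed.

(** The dilation divides x by [rho m] and keeps the frame coordinates, while y, a and b are divided
    explicitly: all eight coordinates scale alike. *)
Lemma unPhi_Phi m : tangent m -> 1 - entry m.1.1.1 2 != 0 -> 0 < rho m ->
  unPhi (Phi m) = (rho m)^-1 *: to_coords m.
Proof.
move=> [q11 q21 qv1 qv2] z1 r0; have rn0 := lt0r_neq0 r0.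
have [x0 x1] := stereo_coord_dilate q11 r0 z1.
have [a0 a1] := frame_coord_dilate m.1.2 q11 r0 z1.
have qq := dilate_unit q11 r0; have qv := dilate_vec_perp q11 r0 qv1.
have nE : unPhi_normal (Phi m) = frame_coord m.1.1.2 m.2 0 / rho m.
  move: qq qv; rewrite /unPhi_normal /Phi /=.
  move: (rho m) rn0 (dilate _ _) (dilate_vec _ _ _) (frame_coord _ _ 0) => r rn0 q v b.
  rewrite !dot3E !entry_row_of //= => qq qv.
  transitivity (((entry q 0 * entry v 0 + entry q 1 * entry v 1 + entry q 2 * entry v 2)
    + b * (entry q 0 * entry q 0 + entry q 1 * entry q 1 + entry q 2 * entry q 2)) / r).
    by field.
  by rewrite qq qv add0r mulr1.
have tE : unPhi_tangent (Phi m) = (rho m)^-1 *: dilate_vec (rho m) m.1.1.1 m.1.2.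
  rewrite /unPhi_tangent nE /Phi /=.
  move: (rho m) rn0 (dilate _ _) (dilate_vec _ _ _) (frame_coord _ _ 0) => r rn0 q v b.
  by apply: entry_ext3; rewrite entryZ !entry_row_of //=; field.
rewrite /unPhi nE tE.
have tgaZ k : frame_coord (Phi m).1 ((rho m)^-1 *: dilate_vec (rho m) m.1.1.1 m.1.2) k =
    (rho m)^-1 * frame_coord (Phi m).1 (dilate_vec (rho m) m.1.1.1 m.1.2) k.
  by rewrite /frame_coord !entryZ; ring.
rewrite !tgaZ [(Phi m).1]/= x0 x1 a0 a1.
by apply: entry_ext => -[|[|[|[|[|[|[|[|]]]]]]]] // _;
  rewrite entryZ !entry_row_of //= ?entry_row_of //= mulrC.
Qed.

Section unPhi.
Variable s : 'rV[R]_3 * 'rV[R]_6.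
Hypotheses (s_unit : sphere_pair s) (z1 : 1 - entry s.1 2 != 0).

Lemma unPhi_perp : dot s.1 (unPhi_tangent s) = 0.
Proof.
have [s1 _] := s_unit; move: s1; rewrite !dot3E !entry_row_of //= => s1.
transitivity (unPhi_normal s - unPhi_normal s *
  (entry s.1 0 * entry s.1 0 + entry s.1 1 * entry s.1 1 + entry s.1 2 * entry s.1 2)).
  by rewrite /unPhi_normal; ring.
by rewrite s1 mulr1 subrr.
Qed.

Lemma unPhi_rho : coords_rho (unPhi s) = 1.
Proof.
have [s1 s2] := s_unit.
rewrite /coords_rho /unPhi !entry_row_of //= frame_coord_norm //;
  last exact: unPhi_perp.
rewrite -[RHS]sqrtr1 -s2 dot6E; congr Num.sqrt.
move: s1; rewrite !dot3E /unPhi_tangent !entry_row_of //= => s1.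
set n := unPhi_normal s.
transitivity (entry s.2 0 * entry s.2 0 + entry s.2 1 * entry s.2 1
  + entry s.2 2 * entry s.2 2
  + entry s.2 3 * entry s.2 3 + entry s.2 4 * entry s.2 4 - 2 * n * unPhi_normal s
  + n ^+ 2 * (entry s.1 0 * entry s.1 0 + entry s.1 1 * entry s.1 1
    + entry s.1 2 * entry s.1 2)
  + n ^+ 2 + entry s.2 5 * entry s.2 5).
  by rewrite /unPhi_normal; ring.
by rewrite s1 -/n; ring.
Qed.

Lemma Phi_unPhi : Phi (of_coords (unPhi s)) = s.
Proof.
have [s1 s2] := s_unit.
have pE : of_coords (unPhi s) = (s.1, stereo (entry s.2 0) (
  entry s.2 1), unPhi_tangent s,
    frame (entry s.2 0) (entry s.2 1) (unPhi_normal s) (entry s.2 5)).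
  rewrite /of_coords /unPhi !entry_row_of //= stereo_stereo_coord //
    frame_frame_coord //; exact: unPhi_perp.
rewrite /Phi rho_of_coords unPhi_rho dilate1 dilate_vec1 pE /=.
have [-> ->] := stereo_coord_stereo (entry s.2 0) (entry s.2 1).
have [-> ->] := frame_coord_frame (entry s.2 0) (entry s.2 1) (unPhi_normal s) (
  entry s.2 5).
rewrite [RHS]surjective_pairing; congr pair.
apply: entry_ext => -[|[|[|[|[|[|]]]]]] // _; rewrite !entry_row_of //= ?divr1 //;
  by rewrite subrK.
Qed.

End unPhi.

(** Both sides are recovered from their images under [unPhi], which are the same normalized
    representative of the ray. *)
Lemma Phi_of_coordsZ (c : R) p : 0 < c -> 0 < coords_rho p ->
  Phi (of_coords (c *: p)) = Phi (of_coords p).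
Proof.
move=> c0 r0.
have rc : coords_rho (c *: p) = c * coords_rho p.
  rewrite /coords_rho !entryZ -[in RHS](gtr0_norm c0) -sqrtr_sqr -sqrtrM ?sqr_ge0 //.
  by congr Num.sqrt; ring.
have rc0 : 0 < coords_rho (c *: p) by rewrite rc mulr_gt0.
have H x : 0 < coords_rho x -> sphere_pair (Phi (of_coords x)) /\
    (1 - entry (Phi (of_coords x)).1 2 != 0) /\ unPhi (Phi (of_coords x))
      = (coords_rho x)^-1 *: x.
  move=> x0; have xr : 0 < rho (of_coords x) by rewrite rho_of_coords.
  split; first by apply: Phi_sphere (of_coords_tangent x) (of_coords_z2 x) xr.
  split.
    by rewrite /= dilate_z_eq1 ?of_coords_z1 //; have [] := of_coords_tangent x.
  by rewrite unPhi_Phi ?of_coords_z1 ?rho_of_coords ?of_coordsK //;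
    exact: of_coords_tangent.
have [sp [zp up]] := H _ r0; have [sc [zc uc]] := H _ rc0.
rewrite -[LHS](Phi_unPhi sc zc) -[RHS](Phi_unPhi sp zp) up uc rc scalerA.
by rewrite invfM -mulrA mulrCA mulVf ?gt_eqF // mulr1.
Qed.

End PhaseCharts.

(** * The separating sphere *)

Section SignedSqrt.
Context {R : realType}.
Implicit Types r c : R.

(* [Num.sqrt] is 0 on negative numbers. *)
Definition signed_sqrt r : R := Num.sqrt r - Num.sqrt (- r).

Lemma signed_sqrtN r : signed_sqrt (- r) = - signed_sqrt r.
Proof. by rewrite /signed_sqrt opprK opprB. Qed.

Lemma signed_sqrtM c r : 0 <= c -> signed_sqrt (c ^+ 2 * r) = c * signed_sqrt r.
Proof.
move=> c0; rewrite /signed_sqrt -mulrN !(sqrtrM _ (sqr_ge0 c)) sqrtr_sqr ger0_norm //.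
by rewrite mulrBr.
Qed.

Lemma signed_sqrt_ge0 r : 0 <= r -> signed_sqrt r = Num.sqrt r.
Proof. by move=> r0; rewrite /signed_sqrt (ler0_sqrtr (_ :
  - r <= 0)) ?subr0 // oppr_le0. Qed.

Lemma signed_sqrt0 : signed_sqrt 0 = 0.
Proof. by rewrite signed_sqrt_ge0 // sqrtr0. Qed.

Lemma cont_at_signed_sqrt (T : topologicalType) (x : T) (f : T -> R) :
  cont_at x f -> cont_at x (fun t => signed_sqrt (f t)).
Proof. by move=> cf; rewrite /signed_sqrt; cont. Qed.

End SignedSqrt.

Section SeparatingFunction.
Context {R : realType}.
Implicit Types (p : 'rV[R]_8) (u : 'rV[R]_7).

Definition sep_sqrt p : R :=
  signed_sqrt (entry p 0 ^+ 2 + entry p 1 ^+ 2 - (entry p 2 ^+ 2 + entry p 3 ^+ 2)).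

(** On the circle y = a = b = 0, which points to the north pole of q1, it equals |x|; on x = a = b =
    0 it equals -|y|. So the two circles lie on opposite sides. *)
Definition sep p : R := entry p 4 - entry p 6 + sep_sqrt p.

Definition swap8 p : 'rV[R]_8 :=
  row_of 7 [:: entry p 2; entry p 3; entry p 0; entry p 1; entry p 6; entry p 7;
    entry p 4; entry p 5].

(** The linear coordinates complementary to a_1 - b_1. *)
Definition proj7 p : 'rV[R]_7 :=
  row_of 6 [:: entry p 0; entry p 1; entry p 2; entry p 3; entry p 4 + entry p 6;
    entry p 5; entry p 7].

(* The entry [a_1 - b_1] is chosen so that [sep (lift8 u) = |u| - 1]. *)
Definition lift8 u : 'rV[R]_8 :=
  let om := Num.sqrt (dot u u) - 1
    - signed_sqrt (entry u 0 ^+ 2 + entry u 1 ^+ 2 - (entry u 2 ^+ 2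
      + entry u 3 ^+ 2)) in
  row_of 7 [:: entry u 0; entry u 1; entry u 2; entry u 3; (entry u 4 + om) / 2;
    entry u 5;
           (entry u 4 - om) / 2; entry u 6].

(** The map induced by [swap8] on the target of [proj7]. *)
Definition swap7 u : 'rV[R]_7 :=
  row_of 6 [:: entry u 2; entry u 3; entry u 0; entry u 1; entry u 4; entry u 6;
    entry u 5].

Lemma sepZ (c : R) p : 0 <= c -> sep (c *: p) = c * sep p.
Proof.
move=> c0; rewrite /sep /sep_sqrt !entryZ mulrDr -signed_sqrtM // mulrBr.
by congr (_ + signed_sqrt _); ring.
Qed.

Lemma sep_swap p : sep (swap8 p) = - sep p.
Proof.
rewrite /sep /sep_sqrt /swap8 !entry_row_of //= -[X in signed_sqrt X]opprB signed_sqrtN.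
by set s := signed_sqrt _; ring.
Qed.

Lemma swap7K : involutive swap7.
Proof.
by move=> u; apply: entry_ext => -[|[|[|[|[|[|[|]]]]]]] // _;
  rewrite /swap7 !entry_row_of.
Qed.

Lemma dot_swap7 u : dot (swap7 u) (swap7 u) = dot u u.
Proof. by rewrite !dot7E /swap7 !entry_row_of //=; ring. Qed.

Lemma proj7_lift8 u : proj7 (lift8 u) = u.
Proof.
apply: entry_ext => -[|[|[|[|[|[|[|]]]]]]] // _;
  rewrite /proj7 /lift8 !entry_row_of //=.
by field.
Qed.

Lemma sep_lift8 u : sep (lift8 u) = Num.sqrt (dot u u) - 1.
Proof.
rewrite /sep /sep_sqrt /lift8 !entry_row_of //=.
by set s := signed_sqrt _; field.
Qed.

Lemma proj7Z (c : R) p : proj7 (c *: p) = c *: proj7 p.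
Proof.
by apply: entry_ext => -[|[|[|[|[|[|[|]]]]]]] // _;
  rewrite entryZ /proj7 !entry_row_of //= !entryZ // mulrDr.
Qed.

Lemma dotZ n (c : R) (v : 'rV[R]_n) : dot (c *: v) (c *: v) = c ^+ 2 * dot v v.
Proof.
by rewrite /dot mulr_sumr; apply: eq_bigr => i _; rewrite !mxE; ring.
Qed.

(* On rays, [p |-> proj7 p / collar p] inverts [lift8], and is defined where
   [collar] is positive. *)
Definition collar p : R := Num.sqrt (dot (proj7 p) (proj7 p)) - sep p.

Lemma collarZ (c : R) p : 0 <= c -> collar (c *: p) = c * collar p.
Proof.
move=> c0; rewrite /collar proj7Z dotZ sepZ // (sqrtrM _ (sqr_ge0 c)).
by rewrite sqrtr_sqr ger0_norm // mulrBr.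
Qed.

Lemma collar_lift8 u : collar (lift8 u) = 1.
Proof. by rewrite /collar proj7_lift8 sep_lift8; ring. Qed.

Lemma lift8_proj7 p : collar p = 1 -> lift8 (proj7 p) = p.
Proof.
rewrite /collar /sep => E.
rewrite /lift8.
have -> : Num.sqrt (dot (proj7 p) (proj7 p)) - 1
  - signed_sqrt (entry (proj7 p) 0 ^+ 2 + entry (proj7 p) 1 ^+ 2
         - (entry (proj7 p) 2 ^+ 2 + entry (proj7 p) 3 ^+ 2)) = entry p 4 - entry p 6.
  rewrite -E /sep_sqrt {2 4 5 6 7}/proj7 !entry_row_of //=; ring.
apply: entry_ext => -[|[|[|[|[|[|[|[|]]]]]]]] // _; rewrite /proj7 !entry_row_of //=;
  by field.
Qed.

Lemma lift8_proj7Z p : 0 < collar p ->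
  lift8 ((collar p)^-1 *: proj7 p) = (collar p)^-1 *: p.
Proof.
move=> c0; rewrite -proj7Z lift8_proj7 // collarZ ?invr_ge0 ?ltW //.
by rewrite mulVf // gt_eqF.
Qed.

Lemma coords_rho_eq0 p : coords_rho p = 0 -> forall k, (2 <= k <= 7)%N -> entry p k = 0.
Proof.
move=> /eqP; rewrite sqrtr_eq0 => p0 k kb.
have H a : 0 <= entry p a ^+ 2 by exact: sqr_ge0.
have := H 2%N; have := H 3%N; have := H 4%N; have := H 5%N.
have := H 6%N; have := H 7%N => h7 h6 h5 h4 h3 h2.
apply/eqP; rewrite -sqrf_eq0; apply/eqP.
by move: k kb => [|[|[|[|[|[|[|[|]]]]]]]] // _; lra.
Qed.

(** Where y = a = b = 0, both [sep] and the norm of [proj7] equal |x|, so [collar] vanishes; but it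
    is 1 on the image of [lift8]. Concretely, entry 4 would be -1/2. *)
Lemma coords_rho_lift8 u : 0 < coords_rho (lift8 u).
Proof.
rewrite lt_neqAle sqrtr_ge0 andbT eq_sym; apply/eqP => /coords_rho_eq0 p0.
have up := proj7_lift8 u.
have u4 : entry u 4 = 0.
  by rewrite -up {1}/proj7 entry_row_of //= !p0 // addr0.
have uk k j : entry (lift8 u) k = entry u j -> (2 <= k <= 7)%N -> entry u j = 0.
  by move=> <-; exact: p0.
have u2 : entry u 2 = 0 by apply: (uk 2%N); rewrite // entry_row_of.
have u3 : entry u 3 = 0 by apply: (uk 3%N); rewrite // entry_row_of.
have u5 : entry u 5 = 0 by apply: (uk 5%N); rewrite // entry_row_of.
have u6 : entry u 6 = 0 by apply: (uk 7%N); rewrite // entry_row_of.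
have := p0 4%N isT; rewrite /lift8 entry_row_of //= dot7E u2 u3 u4 u5 u6.
rewrite !(mulr0, addr0, expr0n, subr0) add0r -!expr2 signed_sqrt_ge0; last first.
  by rewrite addr_ge0 ?sqr_ge0.
by move: (Num.sqrt _) => s E; clear up; lra.
Qed.

(** If [proj7 p] vanishes then x = y = 0, so [sep p] reduces to a_1 - b_1; with a_1 + b_1 = 0 this
    leaves nothing. Hence rays of the cut can be normalized to unit vectors of R^7. *)
Lemma sep0_proj7_neq0 p : 0 < coords_rho p -> sep p = 0 -> 0 < dot (proj7 p) (proj7 p).
Proof.
move=> r0 g0; rewrite lt_neqAle dot_ge0 andbT eq_sym; apply/eqP => /dot_eq0 h0.
have hk k : entry (proj7 p) k = 0 by rewrite h0 entry0.
have := hk 0%N; have := hk 1%N; have := hk 2%N; have := hk 3%N.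
have := hk 4%N; have := hk 5%N; have := hk 6%N.
rewrite /proj7 !entry_row_of //= => p7 p5 p46 p3 p2 p1 p0.
move: g0; rewrite /sep /sep_sqrt p0 p1 p2 p3 expr0n /= addr0 subr0 signed_sqrt0 addr0
  => g0.
have p4 : entry p 4 = 0 by lra.
have p6 : entry p 6 = 0 by lra.
by move: r0; rewrite /coords_rho p2 p3 p4 p5 p6 p7 expr0n /= !addr0 sqrtr0 ltxx.
Qed.

(** The exchange changes the sign of the signed square root but not of |u| - 1, so equivariance is
    claimed on the unit sphere, where the latter vanishes. *)
Lemma lift8_swap7 u : dot u u = 1 -> lift8 (swap7 u) = swap8 (lift8 u).
Proof.
move=> u1; rewrite /lift8 dot_swap7 u1 sqrtr1 subrr !sub0r.
rewrite {5 6 7 8}/swap7 ![entry (row_of _ _) _]entry_row_of //=.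
rewrite -[X in signed_sqrt X]opprB signed_sqrtN; move: (signed_sqrt _) => s.
by apply: entry_ext => -[|[|[|[|[|[|[|[|]]]]]]]] // _;
  rewrite /swap7 /swap8 !entry_row_of //=; field.
Qed.

Section Continuity.
Variables (T : topologicalType) (x : T).

Lemma cont_at_sep (f : T -> 'rV[R]_8) : cont_at x f -> cont_at x (fun t => sep (f t)).
Proof. by move=> cf; apply: cont_atD; [|apply: cont_at_signed_sqrt]; cont. Qed.

Lemma cont_at_proj7 (f : T -> 'rV[R]_8) :
  cont_at x f -> cont_at x (fun t => proj7 (f t)).
Proof.
move=> cf; apply: cont_at_row_of => -[|[|[|[|[|[|[|]]]]]]] //= _; by cont.
Qed.

Lemma cont_at_swap7 (f : T -> 'rV[R]_7) :
  cont_at x f -> cont_at x (fun t => swap7 (f t)).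
Proof.
move=> cf; apply: cont_at_row_of => -[|[|[|[|[|[|[|]]]]]]] //= _; by cont.
Qed.

Lemma cont_at_collar (f : T -> 'rV[R]_8) :
  cont_at x f -> cont_at x (fun t => collar (f t)).
Proof.
move=> cf; rewrite /collar; have := cont_at_proj7 cf => cg.
by apply: cont_atD; [|apply: cont_atN; exact: cont_at_sep]; cont.
Qed.

Lemma cont_at_lift8 (f : T -> 'rV[R]_7) :
  cont_at x f -> cont_at x (fun t => lift8 (f t)).
Proof.
move=> cf.
have cs : cont_at x (fun t => signed_sqrt (entry (f t) 0 ^+ 2 + entry (f t) 1 ^+ 2
    - (entry (f t) 2 ^+ 2 + entry (f t) 3 ^+ 2))).
  by apply: cont_at_signed_sqrt; cont.
apply: cont_at_row_of => -[|[|[|[|[|[|[|[|]]]]]]]] //= _; by cont.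
Qed.

End Continuity.
End SeparatingFunction.

(** * Continuity of the coordinate maps *)

Section ContinuityOfCharts.
Context {R : realType} {T : topologicalType} (x : T).
Local Notation phase := ('rV[R]_3 * 'rV[R]_3 * 'rV[R]_3 * 'rV[R]_3)%type.

Lemma cont_at_stereo_coord (q : T -> 'rV[R]_3) k : 1 - entry (q x) 2 != 0 ->
  cont_at x q -> cont_at x (fun t => stereo_coord (q t) k).
Proof. by move=> z cq; rewrite /stereo_coord; cont. Qed.

Lemma cont_at_frame_coord (q v : T -> 'rV[R]_3) k : 1 - entry (q x) 2 != 0 ->
  cont_at x q -> cont_at x v -> cont_at x (fun t => frame_coord (q t) (v t) k).
Proof.
by move=> z cq cv; have cs := @cont_at_stereo_coord q k z cq; rewrite /frame_coord;
  cont.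
Qed.

Lemma cont_at_stereo (f g : T -> R) : cont_at x f -> cont_at x g ->
  cont_at x (fun t => stereo (f t) (g t)).
Proof.
move=> cf cg; have D0 := lt0r_neq0 (stereo_den_gt0 (f x) (g x)).
by apply: cont_at_row_of => -[|[|[|]]] //= _; cont.
Qed.

Lemma cont_at_frame (f g a b : T -> R) : cont_at x f -> cont_at x g ->
  cont_at x a -> cont_at x b -> cont_at x (fun t => frame (f t) (g t) (a t) (b t)).
Proof.
move=> cf cg ca cb; have D0 := lt0r_neq0 (stereo_den_gt0 (f x) (g x)).
by apply: cont_at_row_of => -[|[|[|]]] //= _; cont.
Qed.

Lemma cont_at_dilate (r : T -> R) (q : T -> 'rV[R]_3) : dilate_den (r x) (q x) != 0 ->
  cont_at x r -> cont_at x q -> cont_at x (fun t => dilate (r t) (q t)).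
Proof.
rewrite /dilate_den => d0 cr cq.
by apply: cont_at_row_of => -[|[|[|]]] //= _; rewrite /dilate_den; cont.
Qed.

Lemma cont_at_dilate_vec (r : T -> R) (q v : T -> 'rV[R]_3) :
  dilate_den (r x) (q x) != 0 -> cont_at x r -> cont_at x q -> cont_at x v ->
  cont_at x (fun t => dilate_vec (r t) (q t) (v t)).
Proof.
rewrite /dilate_den => d0 cr cq cv.
by apply: cont_at_row_of => -[|[|[|]]] //= _; rewrite /dilate_den; cont.
Qed.

Lemma cont_at_of_coords (f : T -> 'rV[R]_8) : cont_at x f ->
  cont_at x (fun t => of_coords (f t)).
Proof.
move=> cf; rewrite /of_coords.
by repeat apply: cont_at_pair; (apply: cont_at_stereo || apply: cont_at_frame); cont.
Qed.

Lemma cont_at_to_coords (f : T -> phase) : 1 - entry (f x).1.1.1 2 != 0 ->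
  1 - entry (f x).1.1.2 2 != 0 -> cont_at x f -> cont_at x (fun t => to_coords (f t)).
Proof.
move=> z1 z2 cf; apply: cont_at_row_of => -[|[|[|[|[|[|[|[|]]]]]]]] //= _;
  (apply: cont_at_stereo_coord || apply: cont_at_frame_coord) => //; cont.
Qed.

Lemma cont_at_rho (f : T -> phase) : 1 - entry (f x).1.1.2 2 != 0 ->
  cont_at x f -> cont_at x (fun t => rho (f t)).
Proof.
move=> z2 cf; have cs k : cont_at x (fun t => stereo_coord (f t).1.1.2 k).
  by apply: cont_at_stereo_coord => //; cont.
by rewrite /rho; cont.
Qed.

Lemma cont_at_Phi (f : T -> phase) : tangent (f x) ->
  1 - entry (f x).1.1.2 2 != 0 -> 0 < rho (f x) ->
  cont_at x f -> cont_at x (fun t => Phi (f t)).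
Proof.
move=> [q11 _ _ _] z2 r0 cf; have rn0 := lt0r_neq0 r0.
have d0 := lt0r_neq0 (dilate_den_gt0 q11 r0).
have cr := cont_at_rho z2 cf.
have cq : cont_at x (fun t => dilate (rho (f t)) (f t).1.1.1).
  by apply: cont_at_dilate => //; cont.
have cv : cont_at x (fun t => dilate_vec (rho (f t)) (f t).1.1.1 (f t).1.2).
  by apply: cont_at_dilate_vec => //; cont.
have cs k : cont_at x (fun t => stereo_coord (f t).1.1.2 k).
  by apply: cont_at_stereo_coord => //; cont.
have ca k : cont_at x (fun t => frame_coord (f t).1.1.2 (f t).2 k).
  by apply: cont_at_frame_coord => //; cont.
apply: cont_at_pair => //.
by apply: cont_at_row_of => -[|[|[|[|[|[|]]]]]] //= _; cont.
Qed.

Lemma cont_at_unPhi (f : T -> 'rV[R]_3 * 'rV[R]_6) : 1 - entry (f x).1 2 != 0 ->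
  cont_at x f -> cont_at x (fun t => unPhi (f t)).
Proof.
move=> z1 cf.
have cn : cont_at x (fun t => unPhi_normal (f t)) by rewrite /unPhi_normal; cont.
have ct : cont_at x (fun t => unPhi_tangent (f t)).
  by apply: cont_at_row_of => -[|[|[|]]] //= _; cont.
have cs k : cont_at x (fun t => stereo_coord (f t).1 k).
  by apply: cont_at_stereo_coord => //; cont.
have ca k : cont_at x (fun t => frame_coord (f t).1 (unPhi_tangent (f t)) k).
  by apply: cont_at_frame_coord => //; cont.
by apply: cont_at_row_of => -[|[|[|[|[|[|[|[|]]]]]]]] //= _; cont.
Qed.

End ContinuityOfCharts.

(** * Maps into subspaces *)

Section Corestriction.

(** A total map with default [a] off [A], so that formulas on the ambient space give maps into the
    subspace without carrying membership proofs. *)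
Definition corestrict (T : Type) (A : set T) (a : A) (v : T) : A :=
  match pselect (A v) with
  | left h => exist _ v (mem_set h)
  | right _ => a
  end.

Lemma corestrictE (T : Type) (A : set T) (a : A) (v : T) :
  A v -> set_val (corestrict a v) = v.
Proof. by rewrite /corestrict; case: pselect. Qed.

Lemma cont_at_set_val (T U : topologicalType) (A : set U) (x : T) (f : T -> A) :
  cont_at x f -> cont_at x (fun t => set_val (f t)).
Proof.
by move=> cf; apply: (cont_at_comp (g := set_val) cf); exact: initial_continuous.
Qed.

Lemma cont_at_corestrict (T U : topologicalType) (A : set U) (a : A) (x : T)
    (f : T -> U) : (\forall t \near x, A (f t)) -> cont_at x f ->
  cont_at x (fun t => corestrict a (f t)).
Proof.
move=> nA cf N; rewrite nbhsE => -[V [[W oW WV] Vx] VN].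
have Ax : A (f x) := nbhs_singleton nA.
have Vval y : V y = W (set_val y) by rewrite -WV.
have Wx : W (f x) by rewrite -(corestrictE a Ax) -Vval.
have nW : \forall t \near x, W (f t) by apply: cf; exact: open_nbhs_nbhs.
have WN t : A (f t) -> W (f t) -> N (corestrict a (f t)).
  by move=> At Wt; apply: VN; rewrite Vval corestrictE.
by apply: filterS2 nA nW => t At Wt; exact: WN.
Qed.

Lemma hausdorff_inj (T U : topologicalType) (f : T -> U) :
  continuous f -> injective f -> hausdorff_space U -> hausdorff_space T.
Proof.
move=> cf injf hU x y xy; apply: injf; apply: hU => A B nA nB.
have [z [Az Bz]] := xy _ _ (cf _ _ nA) (cf _ _ nB).
by exists (f z).
Qed.

End Corestriction.

(** * Disc charts *)

Section DiscChart.
Context {R : realType}.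

Definition S2xS5 : topologicalType :=
  (unit_sphere R 2 * unit_sphere R 5)%type.

Definition S2xS5_val (s : S2xS5) : 'rV[R]_3 * 'rV[R]_6 := (set_val s.1, set_val s.2).

Fact unit_delta n : unit_sphere R n (delta_mx 0 ord0).
Proof.
rewrite /unit_sphere /= /dot (bigD1 ord0) //= big1 ?addr0 => [|i i0].
  by rewrite !mxE !eqxx mulr1.
by rewrite !mxE (negPf i0) andbF mulr0.
Qed.

Definition base n : unit_sphere R n :=
  exist (fun v => v \in unit_sphere R n) _ (mem_set (@unit_delta n)).

Definition to_S2xS5 (s : 'rV[R]_3 * 'rV[R]_6) : S2xS5 :=
  (corestrict (base 2) s.1, corestrict (base 5) s.2).

Lemma to_S2xS5K s : sphere_pair s -> S2xS5_val (to_S2xS5 s) = s.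
Proof.
case: s => s1 s2 [/= h1 h2]; rewrite /S2xS5_val /=.
by congr pair; apply: corestrictE.
Qed.

Lemma S2xS5_val_inj : injective S2xS5_val.
Proof.
move=> [a b] [c d] []; rewrite /= => ac bd.
by congr pair; apply: val_inj.
Qed.

Lemma S2xS5_valP (s : S2xS5) : sphere_pair (S2xS5_val s).
Proof. by split; [exact: (set_valP s.1)|exact: (set_valP s.2)]. Qed.

Lemma S2xS5_valK s : to_S2xS5 (S2xS5_val s) = s.
Proof. by apply: S2xS5_val_inj; rewrite to_S2xS5K //; exact: S2xS5_valP. Qed.

Lemma cont_at_S2xS5_val (T : topologicalType) (x : T) (f : T -> S2xS5) :
  cont_at x f -> cont_at x (fun t => S2xS5_val (f t)).
Proof. by move=> cf; apply: cont_at_pair; apply: cont_at_set_val; cont. Qed.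

Lemma cont_at_to_S2xS5 (T : topologicalType) (x : T) (f : T -> 'rV[R]_3 * 'rV[R]_6) :
  (\forall t \near x, sphere_pair (f t)) -> cont_at x f ->
  cont_at x (fun t => to_S2xS5 (f t)).
Proof.
move=> nf cf; apply: cont_at_pair; apply: cont_at_corestrict; try by cont.
  by apply: filterS nf => t [].
by apply: filterS nf => t [].
Qed.

Lemma S2xS5_hausdorff : hausdorff_space S2xS5.
Proof.
apply: (@hausdorff_inj _ _ S2xS5_val).
- by move=> s; apply: cont_at_S2xS5_val; exact: cont_at_id.
- exact: S2xS5_val_inj.
- exact: norm_hausdorff.
Qed.

Definition ray_point (p : 'rV[R]_8) : S2xS5 := to_S2xS5 (Phi (of_coords p)).

Lemma ray_point_val p : 0 < coords_rho p -> S2xS5_val (ray_point p) = Phi (of_coords p).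
Proof.
move=> p0; apply: to_S2xS5K; apply: Phi_sphere (of_coords_z2 p) _;
  first exact: of_coords_tangent.
by rewrite rho_of_coords.
Qed.

Lemma ray_point_z p : 0 < coords_rho p -> 1 - entry (S2xS5_val (ray_point p)).1 2 != 0.
Proof.
move=> p0; rewrite ray_point_val //= dilate_z_eq1 ?of_coords_z1 ?rho_of_coords //.
by have [] := of_coords_tangent p.
Qed.

Lemma unPhi_ray_point p : 0 < coords_rho p ->
  unPhi (S2xS5_val (ray_point p)) = (coords_rho p)^-1 *: p.
Proof.
move=> p0; rewrite ray_point_val // unPhi_Phi ?of_coords_z1 ?rho_of_coords
  ?of_coordsK //.
exact: of_coords_tangent.
Qed.

Lemma ray_pointZ (c : R) p : 0 < c -> 0 < coords_rho p ->
  ray_point (c *: p) = ray_point p.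
Proof. by move=> c0 p0; rewrite /ray_point Phi_of_coordsZ. Qed.

Lemma ray_point_unPhi (s : S2xS5) : 1 - entry (S2xS5_val s).1 2 != 0 ->
  ray_point (unPhi (S2xS5_val s)) = s.
Proof. by move=> z; rewrite /ray_point Phi_unPhi ?S2xS5_valK //; exact: S2xS5_valP. Qed.

Lemma coords_rho_unPhi (s : S2xS5) : 1 - entry (S2xS5_val s).1 2 != 0 ->
  coords_rho (unPhi (S2xS5_val s)) = 1.
Proof. by move=> z; rewrite unPhi_rho //; exact: S2xS5_valP. Qed.

Lemma cont_at_ray_point (T : topologicalType) (x : T) (f : T -> 'rV[R]_8) :
  (forall t, 0 < coords_rho (f t)) -> cont_at x f ->
    cont_at x (fun t => ray_point (f t)).
Proof.
move=> f0 cf; apply: cont_at_to_S2xS5.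
  apply: nearW => t; apply: Phi_sphere (of_coords_z2 _) _;
    first exact: of_coords_tangent.
  by rewrite rho_of_coords.
apply: cont_at_Phi; [exact: of_coords_tangent|exact: of_coords_z2| |exact:
  cont_at_of_coords].
by rewrite rho_of_coords.
Qed.

(** [lift8] selects the point with [collar] 1 on each ray where [collar] is positive. By [sep_lift8]
    the open unit ball corresponds to the rays with negative [sep], and the rest of R^7 is a collar
    beyond the cut. *)
Definition disc (u : 'rV[R]_7) : S2xS5 := ray_point (lift8 u).

Definition undisc (s : S2xS5) : 'rV[R]_7 :=
  let p := unPhi (S2xS5_val s) in (collar p)^-1 *: proj7 p.

Lemma collar_disc u : collar (unPhi (S2xS5_val (disc u))) = (coords_rho (lift8 u))^-1.
Proof.
have r0 := coords_rho_lift8 u.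
by rewrite unPhi_ray_point // collarZ ?collar_lift8 ?mulr1 // invr_ge0 ltW.
Qed.

Lemma discK : cancel disc undisc.
Proof.
move=> u; have r0 := coords_rho_lift8 u.
rewrite /undisc collar_disc unPhi_ray_point // proj7Z proj7_lift8 invrK scalerA.
by rewrite divff ?scale1r // gt_eqF.
Qed.

Lemma undiscK s : 1 - entry (S2xS5_val s).1 2 != 0 ->
  0 < collar (unPhi (S2xS5_val s)) -> disc (undisc s) = s.
Proof.
move=> z c0; rewrite /disc lift8_proj7Z // ray_pointZ ?invr_gt0 ?coords_rho_unPhi //.
exact: ray_point_unPhi.
Qed.

Lemma sep_disc u :
  sep (unPhi (S2xS5_val (disc u))) = (Num.sqrt (dot u u) - 1) / coords_rho (lift8 u).
Proof.
have r0 := coords_rho_lift8 u.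
by rewrite unPhi_ray_point // sepZ ?sep_lift8 1?mulrC // invr_ge0 ltW.
Qed.

Lemma disc_continuous : continuous disc.
Proof.
move=> u; apply: cont_at_ray_point; first exact: coords_rho_lift8.
by apply: cont_at_lift8; exact: cont_at_id.
Qed.

Lemma near_gt0 (T : topologicalType) (x : T) (f : T -> R) :
  cont_at x f -> 0 < f x -> \forall t \near x, 0 < f t.
Proof. by move=> cf f0; apply: (cvgr_gt _ cf). Qed.

(** The two conditions under which [undisc] is a right inverse are strict inequalities, so they
    persist near [disc u]; there [undisc] keeps its values in [U] by continuity. *)
Lemma disc_open (U : set 'rV[R]_7) : open U -> open (disc @` U).
Proof.
move=> oU; rewrite openE => s [u Uu <-].
have r0 := coords_rho_lift8 u.
have cv : cont_at (disc u) S2xS5_val by apply: cont_at_S2xS5_val; exact: cont_at_id.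
have z0 : 0 < 1 - entry (S2xS5_val (disc u)).1 2.
  rewrite lt_neqAle eq_sym ray_point_z //= subr_ge0.
  by have [/unit_z_bounds /andP[]] := S2xS5_valP (disc u).
have cp := cont_at_unPhi (lt0r_neq0 z0) cv.
have c0 : 0 < collar (unPhi (S2xS5_val (disc u))) by rewrite collar_disc invr_gt0.
have cc := cont_at_collar cp.
have cu : cont_at (disc u) undisc.
  apply: cont_at_row => k _; rewrite /undisc.
  have ch := cont_at_proj7 cp; have cn0 := lt0r_neq0 c0.
  rewrite (_ : (fun t => _) = (fun t => (collar (unPhi (S2xS5_val t)))^-1 *
    entry (proj7 (unPhi (S2xS5_val t))) k)); first by cont.
  by apply/funext => t; rewrite entryZ.
have nz : \forall s \near disc u, 0 < 1 - entry (S2xS5_val s).1 2.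
  by apply: near_gt0 => //; cont.
have nc := near_gt0 cc c0.
have nU : \forall s \near disc u, U (undisc s).
  by apply: cu; rewrite discK; exact: open_nbhs_nbhs.
rewrite /interior /=.
near=> s'; exists (undisc s'); first by near: s'.
by apply: undiscK; [apply: lt0r_neq0|]; near: s'.
Unshelve. all: by end_near. Qed.

Definition disc_chart1 : disc_chart R 7 S2xS5 :=
  DiscChart disc_continuous (can_inj discK) disc_open.

Lemma swap7_continuous : continuous (@swap7 R).
Proof. by move=> u; apply: cont_at_swap7; exact: cont_at_id. Qed.

Lemma disc_swap_continuous : continuous (disc \o @swap7 R).
Proof.
move=> u; apply: continuous_comp; [exact: swap7_continuous|exact: disc_continuous].
Qed.

Lemma disc_swap_open (U : set 'rV[R]_7) : open U -> open ((disc \o @swap7 R) @` U).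
Proof.
move=> oU; rewrite -image_comp; apply: disc_open.
rewrite (_ : _ @` _ = @swap7 R @^-1` U).
  by move/continuousP: swap7_continuous; exact.
apply/seteqP; split=> [_ [v Uv <-]|v Uv] /=; first by rewrite swap7K.
by exists (swap7 v); rewrite ?swap7K.
Qed.

(** [swap7] is an isometry, so the removed disc is the same. The precomposition makes boundary
    parameters agree with those of the first half, because the second half is read through the
    exchange of the factors. *)
Definition disc_chart2 : disc_chart R 7 S2xS5 :=
  DiscChart disc_swap_continuous
    (inj_comp (can_inj discK) (inv_inj (@swap7K R))) disc_swap_open.

(** Points of the disc have finite x, so the fibre over the north pole is disjoint from it; there
    [unPhi] is junk, whence the separate alternative. Elsewhere negative [sep] forces positive
    [collar], so the point lies in the range of the chart. *)
Lemma disc_interior (s : S2xS5) :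
  (~` (disc @` [set u | dot u u < 1])) s <->
  (1 - entry (S2xS5_val s).1 2 = 0 \/ 0 <= sep (unPhi (S2xS5_val s))).
Proof.
split=> [ns|[z|g0]] /=.
- have [z|z] := eqVneq (1 - entry (S2xS5_val s).1 2) 0; [by left|right].
  rewrite leNgt; apply/negP => g0; apply: ns.
  have c0 : 0 < collar (unPhi (S2xS5_val s)).
    by rewrite /collar subr_gt0 (lt_le_trans g0) // sqrtr_ge0.
  exists (undisc s); last exact: undiscK.
  have := sep_disc (undisc s); rewrite undiscK // => gE.
  have : Num.sqrt (dot (undisc s) (undisc s)) < 1.
    rewrite -subr_lt0 -(pmulr_llt0 _ (_ :
      0 < (coords_rho (lift8 (undisc s)))^-1)) -?gE //.
    by rewrite invr_gt0 coords_rho_lift8.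
  by rewrite -[X in _ < X]sqrtr1 ltr_sqrt.
- by move=> [u _ us]; have := ray_point_z (coords_rho_lift8 u);
  rewrite -/(disc u) us z eqxx.
- move=> [u /= u1 us]; move: g0; rewrite -us sep_disc.
  rewrite pmulr_lge0 ?invr_gt0 ?coords_rho_lift8 // subr_ge0 leNgt.
  by rewrite -[X in _ < X]sqrtr1 ltr_sqrt // u1.
Qed.

Lemma disc_boundary u : dot u u = 1 ->
  1 - entry (S2xS5_val (disc u)).1 2 != 0 /\ sep (unPhi (S2xS5_val (disc u))) = 0.
Proof.
move=> u1; split; first exact: ray_point_z (coords_rho_lift8 u).
by rewrite sep_disc u1 sqrtr1 subrr mul0r.
Qed.

(** The common boundary parameter is [proj7 p] scaled to unit length: on the cut [collar p] is the
    norm of [proj7 p]. *)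
Lemma sep0_disc p : 0 < coords_rho p -> sep p = 0 ->
  exists u, [/\ dot u u = 1, disc u = ray_point p & disc (swap7 u)
    = ray_point (swap8 p)].
Proof.
move=> p0 g0; have h0 := sep0_proj7_neq0 p0 g0.
set r := Num.sqrt (dot (proj7 p) (proj7 p)).
have r0 : 0 < r by rewrite sqrtr_gt0.
have rc : collar p = r by rewrite /collar g0 subr0.
have uE : lift8 (r^-1 *: proj7 p) = r^-1 *: p.
  by rewrite -rc lift8_proj7Z // rc.
have ri : 0 < r^-1 by rewrite invr_gt0.
have u1 : dot (r^-1 *: proj7 p) (r^-1 *: proj7 p) = 1.
  by rewrite dotZ exprVn sqr_sqrtr ?dot_ge0 // mulVf // gt_eqF.
exists (r^-1 *: proj7 p); split => //; first by rewrite /disc uE ray_pointZ.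
have sZ : swap8 (r^-1 *: p) = r^-1 *: swap8 p.
  by apply: entry_ext => -[|[|[|[|[|[|[|[|]]]]]]]] // _;
    rewrite entryZ /swap8 !entry_row_of //= entryZ.
have s0 : 0 < coords_rho (swap8 (r^-1 *: p)).
  by rewrite -uE -lift8_swap7 //; exact: coords_rho_lift8.
have sE : swap8 p = r *: swap8 (r^-1 *: p).
  by rewrite sZ scalerA divff ?scale1r // gt_eqF.
by rewrite /disc lift8_swap7 // uE sE ray_pointZ.
Qed.

End DiscChart.

(** * The energy equation on rays *)

Section Ray.
Context {R : realType}.
Implicit Types A B be X Y W s : R.

(* Along the ray [t * p] in R^8, with [s = t ^+ 2], the energy equation reads
   [s * W + be = A / (s * X + 1) + B / (s * Y + 1)]. *)
Lemma ray_unique A B be X Y W s :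
  0 <= A -> 0 < B -> 0 <= X -> 0 <= Y -> 0 <= W -> 0 < Y + W -> 0 < s ->
  W + be = A / (X + 1) + B / (Y + 1) ->
  s * W + be = A / (s * X + 1) + B / (s * Y + 1) -> s = 1.
Proof.
move=> A0 B0 X0 Y0 W0 YW s0 E1 Es.
have X1 : 0 < X + 1 by lra.
have Y1 : 0 < Y + 1 by lra.
have sX1 : 0 < s * X + 1 by rewrite ltr_wpDl // mulr_ge0 // ltW.
have sY1 : 0 < s * Y + 1 by rewrite ltr_wpDl // mulr_ge0 // ltW.
(* One side increases in s and the other decreases: subtracting the equations factors out s - 1,
   with a positive cofactor. *)
have E : (s - 1) * (W + A * X / ((X + 1) * (s * X + 1))
    + B * Y / ((Y + 1) * (s * Y + 1))) = 0.
  transitivity ((s * W + be - (W + be))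
    - (A / (s * X + 1) + B / (s * Y + 1) - (A / (X + 1) + B / (Y + 1)))).
    by field; rewrite !gt_eqF.
  by rewrite E1 Es subrr.
move/eqP: E; rewrite mulf_eq0 => /orP[/eqP|/eqP E]; first by lra.
have P1 : 0 <= A * X / ((X + 1) * (s * X + 1)).
  by rewrite divr_ge0 ?mulr_ge0 // ltW.
have P2 : 0 <= B * Y / ((Y + 1) * (s * Y + 1)).
  by rewrite divr_ge0 ?mulr_ge0 // ltW.
have W00 : W = 0 by lra.
have sqy : 0 < Y by lra.
have P3 : 0 < B * Y / ((Y + 1) * (s * Y + 1)) by rewrite divr_gt0 ?mulr_gt0.
lra.
Qed.

(** Intermediate values: at s = 0 the fractions exceed [be]; for large s either the linear term or
    the decay of both fractions reverses the inequality. The case [A = 0] serves the fibre over the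
    north pole of q1. *)
Lemma ray_exists A B be X Y W :
  0 <= A -> 0 <= B -> 0 <= X -> 0 <= Y -> 0 <= W -> 0 < be -> be < A + B ->
  0 < W \/ 0 < X /\ 0 < Y ->
  exists2 s, 0 < s & s * W + be = A / (s * X + 1) + B / (s * Y + 1).
Proof.
move=> A0 B0 X0 Y0 W0 be0 beAB H.
pose f s := A / (s * X + 1) + B / (s * Y + 1) - s * W.
have den Z s : 0 <= Z -> 0 <= s -> 1 <= s * Z + 1.
  by move=> Z0 s0; rewrite lerDr mulr_ge0.
have fr Z C s : 0 <= C -> 0 <= Z -> 0 <= s -> C / (s * Z + 1) <= C.
  move=> C0 Z0 s0; have d1 := den _ _ Z0 s0.
  by rewrite ler_pdivrMr ?(lt_le_trans ltr01) // ler_peMr.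
have [b b0 fb] : exists2 b, 0 <= b & f b <= be.
  have [W1|[X1 Y1]] := H.
    (* Here the linear term alone cancels the bound A + B on the fractions. *)
    exists ((A + B) / W); first by rewrite divr_ge0 ?addr_ge0 // ltW.
    rewrite /f divfK ?gt_eqF //.
    have b0 : 0 <= (A + B) / W by rewrite divr_ge0 ?addr_ge0 // ltW.
    by have := fr _ _ _ A0 X0 b0; have := fr _ _ _ B0 Y0 b0; lra.
  (* Each summand brings one of the two fractions down to at most [be / 2]. *)
  pose b := 2 * A / (X * be) + 2 * B / (Y * be).
  have bA : 0 <= 2 * A / (X * be) by rewrite divr_ge0 ?mulr_ge0 // ltW.
  have bB : 0 <= 2 * B / (Y * be) by rewrite divr_ge0 ?mulr_ge0 // ltW.
  have b0 : 0 <= b by rewrite addr_ge0.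
  exists b => //; rewrite /f.
  have HA : A / (b * X + 1) <= be / 2.
    rewrite ler_pdivrMr ?(lt_le_trans ltr01) ?den //.
    have -> : A = be / 2 * (2 * A / (X * be) * X).
      by field; rewrite !gt_eqF.
    rewrite ler_pM2l ?divr_gt0 //.
    have : 2 * A / (X * be) * X <= b * X by rewrite ler_wpM2r // lerDl.
    by lra.
  have HB : B / (b * Y + 1) <= be / 2.
    rewrite ler_pdivrMr ?(lt_le_trans ltr01) ?den //.
    have -> : B = be / 2 * (2 * B / (Y * be) * Y).
      by field; rewrite !gt_eqF.
    rewrite ler_pM2l ?divr_gt0 //.
    have : 2 * B / (Y * be) * Y <= b * Y by rewrite ler_wpM2r // lerDr.
    by lra.
  have bW : 0 <= b * W by rewrite mulr_ge0.
  by lra.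
have f0 : be < f 0 by rewrite /f !mul0r !add0r !divr1 subr0.
have cf : {within `[0, b], continuous f}.
  apply: continuous_in_subspaceT => s /set_mem; rewrite /= in_itv /= => /andP[s0 _].
  have nX : s * X + 1 != 0 by rewrite gt_eqF // (lt_le_trans ltr01) // den.
  have nY : s * Y + 1 != 0 by rewrite gt_eqF // (lt_le_trans ltr01) // den.
  by change (cont_at s f); rewrite /f; cont.
have [|s] := IVT b0 cf (v := be).
  by rewrite ge_min le_max fb orbT (ltW f0).
rewrite in_itv /= => /andP[s0 sb] fs; exists s; last by rewrite -fs /f; ring.
by rewrite lt_neqAle s0 andbT; apply/eqP => s00; move: f0; rewrite s00 fs ltxx.
Qed.

End Ray.

(** * The model of the energy surface *)

Section Model.
Context {R : realType}.
Local Notation phase := ('rV[R]_3 * 'rV[R]_3 * 'rV[R]_3 * 'rV[R]_3)%type.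
Implicit Types (m : phase) (p : 'rV[R]_8) (al be : R).

Definition model al1 al2 be m : Prop :=
  tangent m /\ dot m.1.2 m.1.2 + dot m.2 m.2
    = al1 * (1 - entry m.1.1.1 2) + al2 * (1 - entry m.1.1.2 2) - be.

Definition swap_phase m : phase := (m.1.1.2, m.1.1.1, m.2, m.1.2).

(* The part of the model to be embedded in S^2 x S^5 by [Phi]; [to_coords] has
   junk values at the poles. *)
Definition first_half m : Prop :=
  1 - entry m.1.1.1 2 = 0 \/ 1 - entry m.1.1.2 2 != 0 /\ 0 <= sep (to_coords m).

Lemma model_swap al1 al2 be m : model al1 al2 be m -> model al2 al1 be (swap_phase m).
Proof.
move=> [[? ? ? ?] E]; split; first by split.
by rewrite /= addrC E; congr (_ - _); rewrite addrC.
Qed.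

Lemma to_coords_swap m : to_coords (swap_phase m) = swap8 (to_coords m).
Proof.
by apply: entry_ext => -[|[|[|[|[|[|[|[|]]]]]]]] // _;
  rewrite /to_coords /swap8 !entry_row_of.
Qed.

Definition sqx p : R := entry p 0 ^+ 2 + entry p 1 ^+ 2.
Definition sqy p : R := entry p 2 ^+ 2 + entry p 3 ^+ 2.
Definition sqw p : R :=
  entry p 4 ^+ 2 + entry p 5 ^+ 2 + (entry p 6 ^+ 2 + entry p 7 ^+ 2).

Lemma sqx_ge0 p : 0 <= sqx p. Proof. by rewrite addr_ge0 ?sqr_ge0. Qed.
Lemma sqy_ge0 p : 0 <= sqy p. Proof. by rewrite addr_ge0 ?sqr_ge0. Qed.
Lemma sqw_ge0 p : 0 <= sqw p. Proof. by rewrite !addr_ge0 ?sqr_ge0. Qed.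

Lemma sqxZ (c : R) p : sqx (c *: p) = c ^+ 2 * sqx p.
Proof. by rewrite /sqx !entryZ; ring. Qed.
Lemma sqyZ (c : R) p : sqy (c *: p) = c ^+ 2 * sqy p.
Proof. by rewrite /sqy !entryZ; ring. Qed.
Lemma sqwZ (c : R) p : sqw (c *: p) = c ^+ 2 * sqw p.
Proof. by rewrite /sqw !entryZ; ring. Qed.

Lemma coords_rhoE p : coords_rho p = Num.sqrt (sqy p + sqw p).
Proof. by rewrite /coords_rho /sqy /sqw; congr Num.sqrt; ring. Qed.

Lemma coords_rho_gt0 p : (0 < coords_rho p) = (0 < sqy p + sqw p).
Proof. by rewrite coords_rhoE sqrtr_gt0. Qed.

Lemma model_of_coords al1 al2 be p :
  sqw p + be = 2 * al1 / (sqx p + 1) + 2 * al2 / (sqy p + 1) <->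
  model al1 al2 be (of_coords p).
Proof.
have X0 := sqx_ge0 p; have Y0 := sqy_ge0 p.
have X1 : sqx p + 1 != 0 by apply: lt0r_neq0; lra.
have Y1 : sqy p + 1 != 0 by apply: lt0r_neq0; lra.
rewrite /model /= !frame_norm !stereo_z -/(sqx p) -/(sqy p) -[_ + _ + (_ + _)]/(sqw p).
have -> : al1 * (2 / (sqx p + 1)) + al2 * (2 / (sqy p + 1)) =
  2 * al1 / (sqx p + 1) + 2 * al2 / (sqy p + 1) by field; rewrite X1 Y1.
split=> [E|[_ E]]; last by rewrite E subrK.
split; first exact: of_coords_tangent.
by rewrite -E addrK.
Qed.

(** The right side of the energy equation is negative when both q_i are at the north pole and
    positive when one is at the north pole and the other at the south pole. *)
Definition admissible al1 al2 be : Prop :=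
  [/\ 0 < be, be < 2 * al1 & be < 2 * al2].

Section AdmissibleModel.
Variables al1 al2 be : R.
Hypothesis adm : admissible al1 al2 be.

Fact be_gt0 : 0 < be. Proof. by have [] := adm. Qed.

Fact al1_gt0 : 0 < al1.
Proof. by have [b0 /(lt_trans b0) b1 _] := adm; rewrite pmulr_rgt0 in b1. Qed.

Fact al2_gt0 : 0 < al2.
Proof. by have [b0 _ /(lt_trans b0) b1] := adm; rewrite pmulr_rgt0 in b1. Qed.

Local Hint Resolve al1_gt0 al2_gt0 : core.

Lemma tangent_bounds m : tangent m ->
  [/\ 0 <= 1 - entry m.1.1.1 2, 1 - entry m.1.1.1 2 <= 2,
      0 <= 1 - entry m.1.1.2 2 & 1 - entry m.1.1.2 2 <= 2].
Proof.
by move=> [/unit_z_bounds /andP[? ?] /unit_z_bounds /andP[? ?] _ _]; split; lra.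
Qed.

Lemma model_z m : model al1 al2 be m ->
  1 - entry m.1.1.1 2 = 0 -> 1 - entry m.1.1.2 2 != 0.
Proof.
move=> [_ E] z1; apply/eqP => z2; move: E; rewrite z1 z2 !mulr0.
by have := dot_ge0 m.1.2; have := dot_ge0 m.2; have := be_gt0; lra.
Qed.

(** If y and both velocities vanish, q2 rests at the south pole, and the energy equation gives 0 =
    al1 (1 - z1) + 2 al2 - be, which is positive. *)
Lemma rho_gt0 m : model al1 al2 be m -> 1 - entry m.1.1.2 2 != 0 -> 0 < rho m.
Proof.
move=> [tm E] z2; rewrite lt_neqAle sqrtr_ge0 andbT eq_sym; apply/eqP => r0.
have := rho_sqr m; rewrite r0 expr0n /= => S.
have [q11 q21 _ _] := tm.
have := stereo_coord_norm q21 z2.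
have := sqr_ge0 (stereo_coord m.1.1.2 0); have := sqr_ge0 (stereo_coord m.1.1.2 1).
have := dot_ge0 m.1.2; have := dot_ge0 m.2 => d2 d1 y1 y0 yE.
have z22 : 1 - entry m.1.1.2 2 = 2.
  have : 2 / (1 - entry m.1.1.2 2) = 1 by lra.
  by move/(congr1 ( *%R^~ (1 - entry m.1.1.2 2))); rewrite mul1r divfK.
have [z1 _ _ _] := tangent_bounds tm.
have : 0 <= al1 * (1 - entry m.1.1.1 2) by rewrite mulr_ge0 // ltW.
by have [_ _] := adm; rewrite z22 in E; lra.
Qed.

Lemma first_half_z2 m : model al1 al2 be m -> first_half m -> 1 - entry m.1.1.2 2 != 0.
Proof. by move=> mm [z1|[]//]; exact: model_z z1. Qed.

Lemma first_half_total m : model al1 al2 be m ->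
  first_half m \/ first_half (swap_phase m).
Proof.
move=> mm; have [z1|z1] := eqVneq (1 - entry m.1.1.1 2) 0; first by left; left.
have [z2|z2] := eqVneq (1 - entry m.1.1.2 2) 0; first by right; left.
have [g0|g0] := leP 0 (sep (to_coords m)); first by left; right.
by right; right; rewrite to_coords_swap sep_swap oppr_ge0 ltW.
Qed.

Lemma first_half_both m : model al1 al2 be m -> first_half m ->
  first_half (swap_phase m) ->
  [/\ 1 - entry m.1.1.1 2 != 0, 1 - entry m.1.1.2 2 != 0 & sep (to_coords m) = 0].
Proof.
move=> mm [z1|[z2 g0]]; case=> [/= z2'|[/= z1' g0']].
- by have := model_z mm z1; rewrite z2' eqxx.
- by move: z1'; rewrite z1 eqxx.
- by move: z2; rewrite z2' eqxx.
- split=> //; move: g0'; rewrite to_coords_swap sep_swap oppr_ge0 => g0'.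
  by apply/eqP; rewrite eq_le g0 g0'.
Qed.

Lemma Phi_z1 m : model al1 al2 be m -> 1 - entry m.1.1.2 2 != 0 ->
  (1 - entry (Phi m).1 2 == 0) = (1 - entry m.1.1.1 2 == 0).
Proof.
move=> mm z2; have [[q11 _ _ _] _] := mm.
by rewrite /= dilate_z_eq1 //; exact: rho_gt0.
Qed.

Lemma sep_unPhi m : model al1 al2 be m -> 1 - entry m.1.1.1 2 != 0 ->
  1 - entry m.1.1.2 2 != 0 -> sep (unPhi (Phi m)) = (rho m)^-1 * sep (to_coords m).
Proof.
move=> mm z1 z2; have r0 := rho_gt0 mm z2; have [tm _] := mm.
by rewrite unPhi_Phi // sepZ // invr_ge0 ltW.
Qed.

Lemma Phi_first_half m : model al1 al2 be m -> first_half m ->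
  1 - entry (Phi m).1 2 = 0 \/ 0 <= sep (unPhi (Phi m)).
Proof.
move=> mm hm; have z2 := first_half_z2 mm hm.
have [z1|z1] := eqVneq (1 - entry m.1.1.1 2) 0.
  by left; apply/eqP; rewrite Phi_z1 // z1.
right; rewrite sep_unPhi // mulr_ge0 ?invr_ge0 ?sqrtr_ge0 //.
by case: hm => [z10|[]//]; rewrite z10 eqxx in z1.
Qed.

Lemma first_half_swap m : model al1 al2 be m -> first_half m ->
  1 - entry (Phi m).1 2 != 0 -> sep (unPhi (Phi m)) = 0 -> first_half (swap_phase m).
Proof.
move=> mm hm; have z2 := first_half_z2 mm hm; have r0 := rho_gt0 mm z2.
rewrite Phi_z1 // => z1; rewrite sep_unPhi // => /eqP.
rewrite mulf_eq0 invr_eq0 (gt_eqF r0) /= => /eqP g0.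
by right; rewrite to_coords_swap sep_swap g0 oppr0.
Qed.

Lemma to_coords_ray m : model al1 al2 be m -> 1 - entry m.1.1.1 2 != 0 ->
  1 - entry m.1.1.2 2 != 0 ->
  0 < sqy (to_coords m) + sqw (to_coords m) /\
  sqw (to_coords m) + be = 2 * al1 / (sqx (to_coords m) + 1)
    + 2 * al2 / (sqy (to_coords m) + 1).
Proof.
move=> mm z1 z2; have [tm _] := mm; have r0 := rho_gt0 mm z2; split.
  by rewrite -coords_rho_gt0 -rho_of_coords to_coordsK.
by apply/model_of_coords; rewrite to_coordsK.
Qed.

Lemma eq1_of_sqr (c : R) : 0 < c -> c ^+ 2 = 1 -> c = 1.
Proof.
move=> c0 /eqP; rewrite sqrf_eq1 => /orP[/eqP//|/eqP E].
by move: c0; rewrite E; lra.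
Qed.

Lemma pole_coords (q v : 'rV[R]_3) : dot q q = 1 -> dot q v = 0 -> 1 - entry q 2 = 0 ->
  [/\ entry q 0 = 0, entry q 1 = 0, entry q 2 = 1 & entry v 2 = 0].
Proof.
move=> q1 qv z; have z1 : entry q 2 = 1 by lra.
have [q0 q1'] := unit_z1 q1 z1; split=> //.
by move: qv; rewrite dot3E q0 q1' z1; lra.
Qed.

Lemma dilate_pole (r : R) (q v : 'rV[R]_3) : 0 < r -> dot q q = 1 -> dot q v = 0 ->
  1 - entry q 2 = 0 ->
  dilate r q = q /\ dilate_vec r q v = v.
Proof.
move=> r0 q1 qv z; have [q0 q1' q2 v2] := pole_coords q1 qv z.
have d2 : dilate_den r q = 2 by rewrite /dilate_den q2; ring.
split; apply: entry_ext3; rewrite /dilate /dilate_vec d2 !entry_row_of //= ?q0 ?q1'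
  ?q2 ?v2;
  by field.
Qed.

(** [Phi] determines the ray, and [ray_unique] determines the point on it. *)
Lemma Phi_inj m m' : model al1 al2 be m -> model al1 al2 be m' ->
  first_half m -> first_half m' -> Phi m = Phi m' -> m = m'.
Proof.
move=> mm mm' hm hm' E.
have z2 := first_half_z2 mm hm; have z2' := first_half_z2 mm' hm'.
have r0 := rho_gt0 mm z2; have r0' := rho_gt0 mm' z2'.
have [tm Em] := mm; have [tm' Em'] := mm'.
have zz : (1 - entry m.1.1.1 2 == 0) = (1 - entry m'.1.1.1 2 == 0).
  by rewrite -Phi_z1 // E Phi_z1.
(* The ratio of the two positions along the common ray; the goal is [c = 1]. *)
pose c := rho m' / rho m; have c0 : 0 < c by rewrite divr_gt0.
have [z1|z1] := eqVneq (1 - entry m.1.1.1 2) 0; last first.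
  have z1' : 1 - entry m'.1.1.1 2 != 0 by rewrite -zz.
  have pE : to_coords m' = c *: to_coords m.
    have := unPhi_Phi tm' z1' r0'; rewrite -E unPhi_Phi // => pE.
    have -> : to_coords m' = rho m' *: ((rho m')^-1 *: to_coords m').
      by rewrite scalerA divff ?scale1r // gt_eqF.
    by rewrite -pE scalerA.
  have [YW E1] := to_coords_ray mm z1 z2; have [_ Es] := to_coords_ray mm' z1' z2'.
  have c1 : c = 1.
    apply: eq1_of_sqr => //; move: Es; rewrite pE sqxZ sqyZ sqwZ => Es.
    apply: (ray_unique _ _ (sqx_ge0 _) (sqy_ge0 _) (sqw_ge0 _) YW _ E1 Es).
    - by rewrite mulr_ge0 // ltW.
    - by rewrite mulr_gt0.
    - by rewrite exprn_gt0.
  by rewrite -(to_coordsK tm z1 z2) -(to_coordsK tm' z1' z2') pE c1 scale1r.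
(* Over the pole, y, b and the horizontal vector v1 form the ray, and the al1 term is absent: this
   is [ray_unique] with [A = 0]. *)
have z1' : 1 - entry m'.1.1.1 2 = 0 by apply/eqP; rewrite -zz z1.
have [q11 q21 qv1 qv2] := tm; have [q11' q21' qv1' qv2'] := tm'.
have [q0 q1 q2 v2] := pole_coords q11 qv1 z1.
have [q0' q1' q2' v2'] := pole_coords q11' qv1' z1'.
have [dE tE] := dilate_pole r0 q11 qv1 z1.
have [dE' tE'] := dilate_pole r0' q11' qv1' z1'.
have E2 k : entry (Phi m).2 k = entry (Phi m').2 k by rewrite E.
have cE (a b : R) : a / rho m = b / rho m' -> b = c * a.
  move=> ab; rewrite /c mulrAC -mulrA ab mulrCA divff ?mulr1 //.
  by rewrite gt_eqF.
move: (E2 0%N) (E2 1%N) (E2 2%N) (E2 3%N) (E2 4%N) (E2 5%N).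
rewrite /Phi /= dE tE dE' tE' !entry_row_of //= q0 q1 q2 v2 q0' q1' q2' v2'.
rewrite !mulr0 !addr0 !add0r !mulr1.
move=> /cE y0 /cE y1 /cE v0 /cE v1 /cE b0 /cE b1.
have c1 : c = 1.
  apply: eq1_of_sqr => //.
  have y := stereo_coord_norm q21 z2; have y' := stereo_coord_norm q21' z2'.
  have b := frame_coord_norm q21 z2 qv2; have b' := frame_coord_norm q21' z2' qv2'.
  have zE : 1 - entry m.1.1.2 2
    = 2 / (stereo_coord m.1.1.2 0 ^+ 2 + stereo_coord m.1.1.2 1 ^+ 2 + 1).
    by rewrite y; field; rewrite z2.
  have zE' : 1 - entry m'.1.1.2 2
    = 2 / (stereo_coord m'.1.1.2 0 ^+ 2 + stereo_coord m'.1.1.2 1 ^+ 2 + 1).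
    by rewrite y'; field; rewrite z2'.
  have := rho_sqr m; move: Em Em'.
  rewrite z1 z1' zE zE' -b -b' !dot3E v2 v2' v0 v1 b0 b1 y0 y1.
  set Y := stereo_coord _ 0 ^+ 2 + _;
    set W := entry m.1.2 0 * entry m.1.2 0 + _ + _ + _.
  have -> : (c * stereo_coord m.1.1.2 0) ^+ 2 + (c * stereo_coord m.1.1.2 1) ^+ 2
    = c ^+ 2 * Y.
    by rewrite /Y; ring.
  move=> E1 Es rE.
  have YW : 0 < Y + W by rewrite /W addrA -rE exprn_gt0.
  have Y0 : 0 <= Y by rewrite addr_ge0 ?sqr_ge0.
  have W0 : 0 <= W by rewrite /W -!expr2 !addr_ge0 ?sqr_ge0 // mulr0.
  have c20 : 0 < c ^+ 2 by rewrite exprn_gt0.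
  apply: (@ray_unique _ 0 (2 * al2) be 0 Y W) => //; first by rewrite mulr_gt0.
    rewrite mul0r add0r; move: (_ + 1)^-1 E1 => i.
    by rewrite mulr0 add0r /W => E1; lra.
  rewrite mul0r add0r; move: (_ + 1)^-1 Es => i.
  by rewrite /W => Es; lra.
rewrite !c1 !mul1r in y0 y1 v0 v1 b0 b1.
case: m m' {E E2 mm mm' hm hm' r0 r0' c c0 c1 cE zz Em Em' tm tm'
  dE tE dE' tE'} z1 z1' z2 z2' q11 q21 qv1 qv2 q11' q21' qv1' qv2' q0 q1 q2 v2
  q0' q1' q2' v2' y0 y1 v0 v1 b0 b1
  => [[[p1 p2] w1] w2] [[[p1' p2'] w1'] w2'] /=.
move=> z1 z1' z2 z2' q11 q21 qv1 qv2 q11' q21' qv1' qv2' q0 q1 q2 v2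
  q0' q1' q2' v2' y0 y1 v0 v1 b0 b1.
rewrite -(stereo_stereo_coord q21 z2) -(stereo_stereo_coord q21' z2') y0 y1.
rewrite -(frame_frame_coord q21 z2 qv2) -(frame_frame_coord q21' z2' qv2') y0 y1 b0 b1.
by congr (_, _, _, _); apply: entry_ext3; congruence.
Qed.

End AdmissibleModel.
End Model.

(** * Surjectivity onto the complement of the disc, and behaviour near the poles *)

Section ModelSurjectivity.
Context {R : realType}.
Local Notation phase := ('rV[R]_3 * 'rV[R]_3 * 'rV[R]_3 * 'rV[R]_3)%type.
Implicit Types (m : phase) (p : 'rV[R]_8).

Variables al1 al2 be : R.
Hypothesis adm : admissible al1 al2 be.

(** Without velocity part, [0 <= sep p] says |x| >= |y|. This excludes the rays x = a = b = 0, which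
    never meet the surface. *)
Lemma sqx_gt0 p : sqw p = 0 -> 0 <= sep p -> 0 < sqy p -> 0 < sqx p.
Proof.
move=> W0 g0 Y0.
have H a : 0 <= entry p a ^+ 2 by exact: sqr_ge0.
have := H 4%N; have := H 5%N; have := H 6%N; have := H 7%N => h7 h6 h5 h4.
have p4 : entry p 4 = 0.
  by apply/eqP; rewrite -sqrf_eq0; apply/eqP; move: W0; rewrite /sqw; lra.
have p6 : entry p 6 = 0.
  by apply/eqP; rewrite -sqrf_eq0; apply/eqP; move: W0; rewrite /sqw; lra.
move: g0; rewrite /sep /sep_sqrt p4 p6 subr0 add0r -/(sqx p) -/(sqy p).
rewrite lt_neqAle sqx_ge0 andbT => g0; apply/eqP => X0; move: g0.
by rewrite -X0 sub0r signed_sqrtN signed_sqrt_ge0 ?(ltW Y0) // oppr_ge0 leNgt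
  sqrtr_gt0 Y0.
Qed.

(** [ray_exists] finds the point of the surface on the ray through [unPhi s]; over the pole, where
    [unPhi] is junk, the preimage is written down directly. *)
Lemma Phi_surj s : sphere_pair s ->
  1 - entry s.1 2 = 0 \/ 0 <= sep (unPhi s) ->
  exists m, [/\ model al1 al2 be m, first_half m & Phi m = s].
Proof.
move=> ss hs; have [b0 b1 b2] := adm.
have a1 := al1_gt0 adm; have a2 := al2_gt0 adm.
have [z1|z1] := eqVneq (1 - entry s.1 2) 0; last first.
  have g0 : 0 <= sep (unPhi s) by case: hs => // z0; rewrite z0 eqxx in z1.
  have r1 := unPhi_rho ss z1; set p := unPhi s in r1 g0.
  have YW : 0 < sqy p + sqw p by rewrite -coords_rho_gt0 r1.
  have H : 0 < sqw p \/ 0 < sqx p /\ 0 < sqy p.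
    have [W0|W0] := eqVneq (sqw p) 0.
      by right; move: YW; rewrite W0 addr0 => Y0; split=> //; exact: sqx_gt0.
    by left; rewrite lt_neqAle eq_sym W0 sqw_ge0.
  have [|||i i0 iE] := @ray_exists _ (2 * al1) (2 * al2) be _ _ _ _ _
    (sqx_ge0 p) (sqy_ge0 p) (sqw_ge0 p) b0 _ H.
  - by rewrite mulr_ge0 // ltW.
  - by rewrite mulr_ge0 // ltW.
  - by rewrite (lt_trans b1) // ltrDl mulr_gt0.
  pose t := Num.sqrt i.
  have t0 : 0 < t by rewrite sqrtr_gt0.
  have tt : t ^+ 2 = i by rewrite sqr_sqrtr // ltW.
  exists (of_coords (t *: p)); split.
  - by apply/model_of_coords; rewrite sqxZ sqyZ sqwZ tt.
  - right; split; first exact: of_coords_z2.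
    by rewrite of_coordsK sepZ ?(ltW t0) // mulr_ge0 // ltW.
  - by rewrite Phi_of_coordsZ ?r1 // Phi_unPhi.
case: s ss hs z1 => s1 s2 [/= s11 s21] _ z1.
pose Y := entry s2 0 ^+ 2 + entry s2 1 ^+ 2.
pose W := entry s2 2 ^+ 2 + entry s2 3 ^+ 2 + (entry s2 4 ^+ 2 + entry s2 5 ^+ 2).
have Y0 : 0 <= Y by rewrite addr_ge0 ?sqr_ge0.
have W0 : 0 <= W by rewrite !addr_ge0 ?sqr_ge0.
have YW : Y + W = 1 by rewrite -s21 dot6E /Y /W; ring.
have H : 0 < W \/ 0 < (1 : R) /\ 0 < Y.
  have [W00|W00] := eqVneq W 0.
    by right; split=> //; move: YW; rewrite W00 addr0 => ->.
  by left; rewrite lt_neqAle eq_sym W00.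
(* With [A = 0] the first fraction vanishes, and [X = 1] is a dummy positive value. *)
have [||i i0 iE] := @ray_exists _ 0 (2 * al2) be _ _ _ (lexx 0) _
  ler01 Y0 W0 b0 _ H.
- by rewrite mulr_ge0 // ltW.
- by rewrite add0r.
pose t := Num.sqrt i.
have t0 : 0 < t by rewrite sqrtr_gt0.
have tn0 := lt0r_neq0 t0.
have tt : t ^+ 2 = i by rewrite sqr_sqrtr // ltW.
(* At the pole the normal is the third axis: entries 2 and 3 of [s2] give v1, and entry 4 gives the
   first component of b. *)
pose v : 'rV[R]_3 := row_of 2 [:: t * entry s2 2; t * entry s2 3; 0].
have vE : [/\ entry v 0 = t * entry s2 2, entry v 1 = t * entry s2 3 & entry v 2 = 0].
  by rewrite /v !entry_row_of.
have [v0 v1 v2] := vE.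
have z11 : entry s1 2 = 1 by lra.
have [s10 s11'] := unit_z1 s11 z11.
have sv : dot s1 v = 0 by rewrite dot3E v0 v1 v2 s10 s11'; ring.
pose m : phase := (s1, stereo (t * entry s2 0) (t * entry s2 1), v,
  frame (t * entry s2 0) (t * entry s2 1) (t * entry s2 4) (t * entry s2 5)).
have [y0 y1] := stereo_coord_stereo (t * entry s2 0) (t * entry s2 1).
have [c0 c1] := frame_coord_frame (t * entry s2 0) (t * entry s2 1) (t
  * entry s2 4) (t * entry s2 5).
have tm : tangent m by split; rewrite /= ?stereo_unit ?frame_perp.
have vv : dot v v = t ^+ 2 * (entry s2 2 ^+ 2 + entry s2 3 ^+ 2).
  by rewrite dot3E v0 v1 v2; ring.
have rE : rho m = t.
  rewrite /rho /= y0 y1 vv frame_norm -[RHS](gtr0_norm t0) -sqrtr_sqr.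
  congr Num.sqrt; rewrite -[RHS]mulr1 -YW /Y /W; ring.
have [dE tE] := dilate_pole t0 s11 sv z1.
exists m; split; [split=> //|by left|].
- rewrite /= vv frame_norm stereo_z z1 mulr0 add0r.
  have D0 : i * Y + 1 != 0 by rewrite gt_eqF // ltr_wpDl // mulr_ge0 // ltW.
  have -> : (t * entry s2 0) ^+ 2 + (t * entry s2 1) ^+ 2 = i * Y by rewrite /Y -tt;
    ring.
  move: iE; rewrite mul0r add0r => iE.
  transitivity (i * W); first by rewrite /W -tt; ring.
  by rewrite -[LHS](addrK be) iE; field.
- rewrite /Phi rE /= dE tE; congr pair.
  apply: entry_ext => -[|[|[|[|[|[|]]]]]] // _;
    rewrite entry_row_of //= ?y0 ?y1 ?c0 ?c1;
    by rewrite ?v0 ?v1 ?v2 ?s10 ?s11' ?z11; field.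
Qed.

(** Expanded, 4 al1 / be keeps al1 (1 - z1) below be / 2, 4 al2 / be bounds Y + 1, and 4 (al1 + al2)
    bounds twice the squared velocities, hence (a_1 - b_1)^2. *)
Let kappa : R := 4 * (al1 + al2) * (be^-1 + 1).

Fact kappa_gt0 : 0 < kappa.
Proof.
have [b0 _ _] := adm; have a1 := al1_gt0 adm; have a2 := al2_gt0 adm.
by rewrite !mulr_gt0 ?addr_gt0 ?invr_gt0.
Qed.

(* Close to the pole of the first factor [1 - z1] is small, hence [X] is
   large, while [Y] and the velocities are bounded. *)
Lemma sep_near_pole m : model al1 al2 be m -> 1 - entry m.1.1.1 2 < 2 / kappa ->
  1 - entry m.1.1.1 2 != 0 -> 1 - entry m.1.1.2 2 != 0 /\ 0 < sep (to_coords m).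
Proof.
have [b0 _ _] := adm; have a1 := al1_gt0 adm; have a2 := al2_gt0 adm.
have k0 := kappa_gt0.
move=> mm zk z1n; have [tm E] := mm; have [z10 z12 z20 z22] := tangent_bounds tm.
have z1 : 0 < 1 - entry m.1.1.1 2 by rewrite lt_neqAle eq_sym z1n.
have kz : kappa * (1 - entry m.1.1.1 2) < 2 by rewrite mulrC -ltr_pdivlMr.
have D1 := dot_ge0 m.1.2; have D2 := dot_ge0 m.2.
have b'0 : 0 < be^-1 by rewrite invr_gt0.
have bb : be * be^-1 = 1 by rewrite divff // gt_eqF.
have kE : be * kappa = 4 * (al1 + al2) * (1 + be).
  by rewrite -[X in _ * (X + _)]bb /kappa; ring.
have z1b : al1 * (1 - entry m.1.1.1 2) <= be / 2.
  have : be * (kappa * (1 - entry m.1.1.1 2)) < be * 2 by rewrite ltr_pM2l.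
  rewrite mulrA kE.
  have p1 : 0 <= al2 * (1 + be) * (1 - entry m.1.1.1 2).
    apply: mulr_ge0 => //; apply: mulr_ge0; first exact: ltW.
    by apply: addr_ge0 => //; exact: ltW.
  have p2 : 0 <= al1 * be * (1 - entry m.1.1.1 2) by rewrite !mulr_ge0 // ltW.
  by move: p1 p2; clear => p1 p2 H; lra.
(* The second factor has to supply at least half of [be], which keeps q2 away from its pole. *)
have z2b : be / 2 <= al2 * (1 - entry m.1.1.2 2) by move: E D1 D2 z1b;
  clear => E D1 D2 z1b; lra.
have z2 : 0 < 1 - entry m.1.1.2 2.
  by rewrite -(pmulr_rgt0 _ a2) (lt_le_trans _ z2b) // divr_gt0.
have z2n := lt0r_neq0 z2; split=> //.
have [q11 q21 qv1 qv2] := tm.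
set p := to_coords m.
have pX : sqx p + 1 = 2 / (1 - entry m.1.1.1 2).
  by rewrite -stereo_coord_norm // /sqx /p /to_coords !entry_row_of //=.
have pY : sqy p + 1 = 2 / (1 - entry m.1.1.2 2).
  by rewrite -stereo_coord_norm // /sqy /p /to_coords !entry_row_of //=.
have Xb : kappa < sqx p + 1 by rewrite pX ltr_pdivlMr.
have Yb : sqy p + 1 <= 4 * al2 * be^-1.
  rewrite pY ler_pdivrMr //.
  have : be^-1 * (be / 2) <= be^-1 * (al2 * (1 - entry m.1.1.2 2)).
    by rewrite ler_pM2l.
  rewrite mulrA [be^-1 * be]mulrC bb mul1r => H.
  by move: H; clear => H; lra.
have Wb : sqw p <= 2 * (al1 + al2).
  have -> : sqw p = dot m.1.2 m.1.2 + dot m.2 m.2.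
    by rewrite /sqw /p /to_coords !entry_row_of //= !frame_coord_norm.
  have h1 : al1 * (1 - entry m.1.1.1 2) <= al1 * 2 by rewrite ler_pM2l.
  have h2 : al2 * (1 - entry m.1.1.2 2) <= al2 * 2 by rewrite ler_pM2l.
  by move: E b0 h1 h2; clear => E b0 h1 h2; lra.
have om : (entry p 4 - entry p 6) ^+ 2 <= 2 * sqw p.
  have H a : 0 <= entry p a ^+ 2 by exact: sqr_ge0.
  have := sqr_ge0 (entry p 4 + entry p 6); have := H 5%N; have := H 7%N.
  rewrite /sqw !sqrrD sqrrN mulrN; move: (entry p 4 * entry p 6) => c; lra.
have XY : (entry p 4 - entry p 6) ^+ 2 < sqx p - sqy p.
  have kk : kappa = 4 * al1 * be^-1 + 4 * al2 * be^-1 + 4 * (al1 + al2).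
    by rewrite /kappa; ring.
  have : 0 < al1 * be^-1 by rewrite mulr_gt0.
  by move: kk om Wb Yb Xb; clear => *; lra.
rewrite /sep /sep_sqrt -/(sqx p) -/(sqy p) signed_sqrt_ge0; last first.
  by rewrite (le_trans (sqr_ge0 _) (ltW XY)).
have : `|entry p 4 - entry p 6| < Num.sqrt (sqx p - sqy p).
  by rewrite -sqrtr_sqr ltr_sqrt // (le_lt_trans (sqr_ge0 _) XY).
by rewrite ltr_norml => /andP[H _]; rewrite -ltrBlDr sub0r.
Qed.

End ModelSurjectivity.

(** * Closedness of the halves *)

Section HalfClosed.
Context {R : realType}.
Local Notation phase := ('rV[R]_3 * 'rV[R]_3 * 'rV[R]_3 * 'rV[R]_3)%type.
Variables al1 al2 be : R.
Hypothesis adm : admissible al1 al2 be.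

Fact adm_swap : admissible al2 al1 be.
Proof. by case: adm. Qed.

(** Off the poles the complement is open by continuity of [sep]. At the north pole of q2 [to_coords]
    is junk, and [sep_near_pole] for the exchanged factors shows that [sep] is negative nearby. *)
Lemma first_half_closed (T : topologicalType) (f : T -> phase) :
  (forall t, model al1 al2 be (f t)) -> (forall x, cont_at x f) ->
  closed [set t | first_half (f t)].
Proof.
move=> mf cf; rewrite -openC openE => x /= nh; rewrite /interior.
have [tx _] := mf x; have [z1 _ z2 _] := tangent_bounds tx.
have z1p : 0 < 1 - entry (f x).1.1.1 2.
  by rewrite lt_neqAle z1 andbT; apply/eqP => z0; apply: nh; left; rewrite -z0.
have cfx := cf x.
have n1 : \forall t \near x, 0 < 1 - entry (f t).1.1.1 2.
  by apply: near_gt0 => //; cont.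
have [z20|z20] := eqVneq (1 - entry (f x).1.1.2 2) 0.
  (* The threshold of [sep_near_pole] with [al1] and [al2] exchanged. *)
  pose d := 2 / (4 * (al2 + al1) * (be^-1 + 1)).
  have n2 : \forall t \near x, 0 < d - (1 - entry (f t).1.1.2 2).
    apply: near_gt0; first by cont.
    by rewrite z20 subr0 divr_gt0 //; exact: (kappa_gt0 adm_swap).
  apply: filterS2 n1 n2 => t t1; rewrite subr_gt0 => t2 /=.
  case=> [E|[t20 g0]]; first by rewrite E ltxx in t1.
  have [_] := sep_near_pole adm_swap (model_swap (mf t)) t2 t20.
  by rewrite to_coords_swap sep_swap oppr_gt0 ltNge g0.
have g0 : 0 < - sep (to_coords (f x)).
  by rewrite oppr_gt0 ltNge; apply/negP => g0; apply: nh; right.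
have cu : cont_at x (fun t => to_coords (f t)).
  by apply: cont_at_to_coords => //; rewrite gt_eqF.
have n2 : \forall t \near x, 0 < - sep (to_coords (f t)).
  by apply: near_gt0 => //; apply: cont_atN; exact: cont_at_sep.
apply: filterS2 n1 n2 => t t1; rewrite oppr_gt0 => t2 /=.
case=> [E|[_]]; first by rewrite E ltxx in t1.
by rewrite leNgt t2.
Qed.

End HalfClosed.

(** * The model as a connected sum *)

Section ModelConnectedSum.
Context {R : realType}.
Local Notation phase := ('rV[R]_3 * 'rV[R]_3 * 'rV[R]_3 * 'rV[R]_3)%type.
Local Notation S2xS5 := (@S2xS5 R).

Lemma cont_at_to_S2xS5_Phi (al1 al2 be : R) (T : topologicalType) (x : T)
    (f : T -> phase) : admissible al1 al2 be ->
  (forall t, model al1 al2 be (f t)) -> first_half (f x) -> cont_at x f ->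
  cont_at x (fun t => to_S2xS5 (Phi (f t))).
Proof.
move=> adm mf hf cf.
have zp t : 1 - entry (f t).1.1.2 2 != 0 -> 0 < 1 - entry (f t).1.1.2 2.
  move=> z; rewrite lt_neqAle eq_sym z.
  by have [_ _ ->] := tangent_bounds (proj1 (mf t)).
have z2 := first_half_z2 adm (mf x) hf.
have n2 : \forall t \near x, 0 < 1 - entry (f t).1.1.2 2.
  by apply: near_gt0; [cont|exact: zp].
apply: cont_at_to_S2xS5; last first.
  by apply: cont_at_Phi => //; [exact: (proj1 (mf x))|exact: (rho_gt0 adm (mf x) z2)].
apply: filterS n2 => t /lt0r_neq0 zt; apply: Phi_sphere => //.
  exact: (proj1 (mf t)).
exact: (rho_gt0 adm (mf t) zt).
Qed.

Lemma disc_swap_image :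
  (@disc R \o @swap7 R) @` [set u | dot u u < 1] = @disc R @` [set u | dot u u < 1].
Proof.
apply/seteqP; split=> _ [u /= u1 <-].
  by exists (swap7 u); rewrite /= ?dot_swap7.
by exists (swap7 u); rewrite /= ?dot_swap7 ?swap7K.
Qed.

Lemma connsum_of_model (al1 al2 be : R) (X : topologicalType) (F : X -> phase) :
  admissible al1 al2 be -> compact [set: X] -> (forall x, cont_at x F) ->
  injective F -> (forall x, model al1 al2 be (F x)) ->
  (forall m, model al1 al2 be m -> exists x, F x = m) ->
  homeomorphic_to_connsum R 7 X S2xS5 S2xS5.
Proof.
move=> adm cX cF injF mF surjF.
pose M (b : bool) : topologicalType := if b then S2xS5 else S2xS5.
pose e (b : bool) : disc_chart R 7 (M b) :=
  match b with true => @disc_chart2 R | false => @disc_chart1 R end.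
(* Index [true] exchanges the factors and the parameters, so the same lemmas serve both halves. The
   maps [f] below are defined by cases so that the type [M b] reduces. *)
pose G (b : bool) x : phase := if b then swap_phase (F x) else F x.
pose f (b : bool) : X -> M b :=
  match b with
  | true => fun x => to_S2xS5 (Phi (G true x))
  | false => fun x => to_S2xS5 (Phi (G false x))
  end.
pose al (b : bool) := if b then al2 else al1.
have admb b : admissible (al b) (al (~~ b)) be.
  by case: b => //; exact: adm_swap.
have mG b x : model (al b) (al (~~ b)) be (G b x).
  by case: b; [exact: model_swap|exact: mF].
have cG b x : cont_at x (G b).
  have cFx := cF x; case: b => //; rewrite /G /swap_phase; cont.
have swap_phaseK m : swap_phase (swap_phase m) = m by case: m => [[[? ?] ?] ?].
have injG b : injective (G b).
  case: b => // x y E; apply: injF; rewrite -[F x]swap_phaseK -[F y]swap_phaseK.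
  by congr swap_phase.
have surjG b m : model (al b) (al (~~ b)) be m -> exists x, G b x = m.
  case: b => [/model_swap /surjF [x Fx]|]; last exact: surjF.
  exists x.
  by rewrite /G Fx swap_phaseK.
have GN b x : G (~~ b) x = swap_phase (G b x) by case: b; rewrite /G /= ?swap_phaseK.
have zG b x : first_half (G b x) -> 1 - entry (G b x).1.1.2 2 != 0.
  move=> hx; exact: (first_half_z2 (admb b) (mG b x) hx).
have sG b x : first_half (G b x) -> sphere_pair (Phi (G b x)).
  move=> hx; have z2 := zG b x hx; apply: Phi_sphere => //.
    exact: (proj1 (mG b x)).
  exact: (rho_gt0 (admb b) (mG b x) z2).
have PhiE b x : first_half (G b x) -> S2xS5_val (to_S2xS5 (Phi (G b x))) = Phi (G b x).
  by move=> hx; rewrite to_S2xS5K //; exact: sG.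
have imG b : (fun x => to_S2xS5 (Phi (G b x))) @` [set x | first_half (G b x)] =
    ~` (@disc R @` [set u | dot u u < 1]).
  apply/seteqP; split=> [_ [x hx <-]|s /disc_interior hs].
    apply/disc_interior; rewrite PhiE //.
    exact: (Phi_first_half (admb b) (mG b x) hx).
  have [m [mm hm ms]] := Phi_surj (admb b) (S2xS5_valP s) hs.
  have [x xm] := surjG b m mm.
  by exists x; rewrite /= xm // ms S2xS5_valK.
have bdG b x u : first_half (G b x) -> dot u u = 1 -> to_S2xS5 (Phi (G b x)) = disc u ->
    first_half (G (~~ b) x).
  move=> hx u1 xu; have [uz us] := disc_boundary u1; rewrite GN.
  apply: (first_half_swap (admb b) (mG b x) hx).
    by rewrite -PhiE // xu.
  by rewrite -PhiE // xu.
exists e; apply: (@homeomorphic_connsum R 7 M e X (fun b =>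
  [set x | first_half (G b x)]) f).
- exact: cX.
- by case; exact: S2xS5_hausdorff.
- by move=> b; exact: (first_half_closed (admb b) (mG b) (cG b)).
- move=> x; have [hx|hx] := first_half_total (mG false x); first by exists false.
  by exists true.
- by case=> x hx; [exact: (cont_at_to_S2xS5_Phi (admb true) (mG true) hx (cG true
  x))|exact: (cont_at_to_S2xS5_Phi (admb false) (mG false) hx (cG false x))].
- have injf b x y : first_half (G b x) -> first_half (G b y) ->
      to_S2xS5 (Phi (G b x)) = to_S2xS5 (Phi (G b y)) -> x = y.
    move=> hx hy E; apply: (injG b).
    apply: (Phi_inj (admb b) (mG b x) (mG b y) hx hy).
    by rewrite -(PhiE b x hx) -(PhiE b y hy) E.
  by case=> x y hx hy; [exact: (injf true)|exact: (injf false)].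
- case; rewrite /complement_disc; last exact: imG.
  by rewrite [X in ~` X]disc_swap_image; exact: imG.
- case=> x u hx u1 E; last exact: (bdG false x u hx u1 E).
  by apply: (bdG true x (swap7 u) hx); rewrite ?dot_swap7.
- move=> x hx.
  have [z1 z2 g0] := first_half_both (admb false) (mG false x) (hx false) (hx true).
  have [tx _] := mG false x.
  have p0 : 0 < coords_rho (to_coords (F x)).
    rewrite -rho_of_coords to_coordsK //; exact: (rho_gt0 (admb false) (mG false x) z2).
  have [u [u1 du dsu]] := sep0_disc p0 g0.
  have tx' : tangent (swap_phase (F x)) by have [] := mG true x.
  exists u; split=> //; case; rewrite /f /=.
    by rewrite dsu /ray_point -to_coords_swap to_coordsK.
  by rewrite du /ray_point to_coordsK.
Qed.

End ModelConnectedSum.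

(** * Compactness and vector-valued continuity *)

Lemma compact_set_type (T : topologicalType) (A : set T) :
  compact A -> compact [set: A].
Proof.
move=> cA F PF _; pose E := set_val @ F.
have EA : E A.
  change (F (set_val @^-1` A)); rewrite (_ : _ @^-1` _ = setT).
    exact: filterT.
  by apply/seteqP; split=> t // _; exact: (set_valP t).
have [a [Aa cla]] := cA E _ EA.
exists (exist (fun v => v \in A) a (mem_set Aa)); split=> // B N FB.
rewrite nbhsE => -[V [[W oW WV] Va] VN].
have Vval y : V y = W (set_val y) by rewrite -WV.
have Wa : W a by move: Va; rewrite Vval.
have EB : E (set_val @` B).
  change (F (set_val @^-1` (set_val @` B))).
  by apply: filterS FB => t Bt; exists t.
have [_ [[t Bt <-] Wt]] := cla _ _ EB (open_nbhs_nbhs (conj oW Wa)).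
by exists t; split=> //; apply: VN; rewrite Vval.
Qed.

Lemma compact_box (R : realType) (n : nat) (B : R) :
  compact [set v : 'rV[R]_n.+1 | forall k, `|entry v k| <= B].
Proof.
have := @rV_compact R n.+1 (fun=> `[- B, B]%classic) (fun=> @segment_compact R (- B) B).
congr compact; apply/seteqP; split=> v /= H.
  by move=> k; rewrite /entry; have := H (inord k); rewrite /= in_itv /= ler_norml.
move=> i; have := H i; rewrite /entry inord_val ler_norml.
by rewrite in_itv.
Qed.

Lemma entry_sqr_le_dot (R : realType) (n : nat) (v : 'rV[R]_n.+1) k :
  entry v k ^+ 2 <= dot v v.
Proof.
rewrite /dot (bigD1 (inord k)) //= -expr2 lerDl.
by apply: sumr_ge0 => i _; rewrite -expr2 sqr_ge0.
Qed.

Section VectorContinuity.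
Context {R : realType} {T : topologicalType} (x : T) (n : nat).
Implicit Types (f g : T -> 'rV[R]_n.+1) (c : T -> R).

Lemma cont_at_addv f g : cont_at x f -> cont_at x g ->
  cont_at x (fun t => f t + g t).
Proof.
move=> cf cg; apply: cont_at_row => k _.
rewrite (_ : (fun t => _) = fun t => entry (f t) k + entry (g t) k); first by cont.
by apply/funext => t; rewrite /entry mxE.
Qed.

Lemma cont_at_scalev c f : cont_at x c -> cont_at x f ->
  cont_at x (fun t => c t *: f t).
Proof.
move=> cc cf; apply: cont_at_row => k _.
rewrite (_ : (fun t => _) = fun t => c t * entry (f t) k); first by cont.
by apply/funext => t; rewrite entryZ.
Qed.

Lemma cont_at_oppv f : cont_at x f -> cont_at x (fun t => - f t).
Proof.
move=> cf; apply: cont_at_row => k _.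
rewrite (_ : (fun t => _) = fun t => - entry (f t) k); first by cont.
by apply/funext => t; rewrite /entry mxE.
Qed.

End VectorContinuity.

Lemma cont_at_squeeze0 (R : realType) (T : topologicalType) (x : T) (f g : T -> R) :
  f x = 0 -> g x = 0 -> (forall t, `|f t| <= g t) -> cont_at x g -> cont_at x f.
Proof.
move=> f0 g0 fg cg; rewrite /cont_at f0; apply/cvgr0Pnorm_lt => e e0.
have : \forall t \near x, 0 < e - g t.
  by apply: near_gt0; [cont|rewrite g0 subr0].
by apply: filterS => t; rewrite subr_gt0; exact: le_lt_trans.
Qed.

(** * Energy surfaces *)

Section EnergySurface.
Context {R : realType}.
Variables m1 m2 l1 l2 g : R.
Hypotheses (hm1 : 0 < m1) (hm2 : 0 < m2) (hl1 : 0 < l1) (hl2 : 0 < l2).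
Local Notation phase := ('rV[R]_3 * 'rV[R]_3 * 'rV[R]_3 * 'rV[R]_3)%type.
Implicit Types w : phase.

Let m1n : m1 != 0. Proof. exact: lt0r_neq0. Qed.
Let m2n : m2 != 0. Proof. exact: lt0r_neq0. Qed.
Let l1n : l1 != 0. Proof. exact: lt0r_neq0. Qed.
Let l2n : l2 != 0. Proof. exact: lt0r_neq0. Qed.

Definition relative_momentum (p1 p2 : 'rV[R]_3) : 'rV[R]_3 := l1^-1 *: p1 - l2^-1 *: p2.

Definition kinetic (p1 p2 : 'rV[R]_3) : R :=
  2^-1 * (m1^-1 * dot (relative_momentum p1 p2) (relative_momentum p1 p2)
          + m2^-1 * dot (l2^-1 *: p2) (l2^-1 *: p2)).

Local Notation vel1 := (velocity1 m1 l1 l2).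
Local Notation vel2 := (velocity2 m1 m2 l1 l2).

(** The form used in the model. The kinetic energy is a different quadratic form, as it couples the
    two velocities; [rescale] moves each of its level sets radially, which preserves tangency. *)
Definition speed2 (p1 p2 : 'rV[R]_3) : R :=
  dot (vel1 p1 p2) (vel1 p1 p2) + dot (vel2 p1 p2) (vel2 p1 p2).

Lemma kinetic_ge0 p1 p2 : 0 <= kinetic p1 p2.
Proof.
rewrite /kinetic mulr_ge0 ?invr_ge0 // addr_ge0 // mulr_ge0 ?dot_ge0 //
  invr_ge0 ltW //.
Qed.

Lemma speed2_ge0 p1 p2 : 0 <= speed2 p1 p2.
Proof. by rewrite addr_ge0 ?dot_ge0. Qed.

Lemma kinetic_eq0 p1 p2 : kinetic p1 p2 = 0 -> p1 = 0 /\ p2 = 0.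
Proof.
have a0 := dot_ge0 (relative_momentum p1 p2); have b0 := dot_ge0 (l2^-1 *: p2).
move=> /eqP; rewrite /kinetic mulf_eq0 invr_eq0 pnatr_eq0 /=.
have e1 : 0 <= m1^-1 * dot (relative_momentum p1 p2) (relative_momentum p1 p2).
  by rewrite mulr_ge0 // invr_ge0 ltW.
have e2 : 0 <= m2^-1 * dot (l2^-1 *: p2) (l2^-1 *: p2).
  by rewrite mulr_ge0 // invr_ge0 ltW.
rewrite (paddr_eq0 e1 e2) !mulf_eq0 !invr_eq0.
rewrite (negPf m1n) (negPf m2n) /= => /andP[/eqP/dot_eq0 a00 /eqP/dot_eq0 /eqP].
rewrite scaler_eq0 invr_eq0 (negPf l2n) /= => /eqP p20.
move: a00; rewrite /relative_momentum p20 scaler0 subr0 => /eqP.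
by rewrite scaler_eq0 invr_eq0 (negPf l1n) /= => /eqP.
Qed.

Lemma speed2_eq0 p1 p2 : speed2 p1 p2 = 0 -> p1 = 0 /\ p2 = 0.
Proof.
move=> /eqP; rewrite paddr_eq0 ?dot_ge0 // => /andP[/eqP/dot_eq0 v1 /eqP/dot_eq0 v2].
rewrite [in p1 = 0](legendre1 p1 p2 m1n m2n l1n l2n).
rewrite [in p2 = 0](legendre2 p1 p2 m1n m2n l1n l2n).
by rewrite v1 v2 !scaler0 !addr0 !scaler0 addr0.
Qed.

Lemma relative_momentumZ (c : R) p1 p2 : relative_momentum (c *: p1) (c *:
  p2) = c *: relative_momentum p1 p2.
Proof. by rewrite /relative_momentum scalerBr !scalerA ![_ * c]mulrC. Qed.

Lemma vel1Z (c : R) p1 p2 : vel1 (c *: p1) (c *: p2) = c *: vel1 p1 p2.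
Proof. by apply/rowP => i; rewrite /velocity1 !mxE; ring. Qed.

Lemma vel2Z (c : R) p1 p2 : vel2 (c *: p1) (c *: p2) = c *: vel2 p1 p2.
Proof. by apply/rowP => i; rewrite /velocity2 !mxE; ring. Qed.

Lemma kineticZ (c : R) p1 p2 : kinetic (c *: p1) (c *: p2) = c ^+ 2 * kinetic p1 p2.
Proof.
rewrite /kinetic relative_momentumZ [l2^-1 *: (c *:
  p2)]scalerA [l2^-1 * c]mulrC -scalerA.
by rewrite !dotZ; ring.
Qed.

Lemma speed2Z (c : R) p1 p2 : speed2 (c *: p1) (c *: p2) = c ^+ 2 * speed2 p1 p2.
Proof.
rewrite /speed2 vel1Z vel2Z (dotZ _ (vel1 p1 p2)) (dotZ _ (vel2 p1 p2)).
by rewrite mulrDr.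
Qed.

(* At zero momentum the division by zero gives [gauge = 0]. *)
Definition gauge (p1 p2 : 'rV[R]_3) : R :=
  Num.sqrt (kinetic p1 p2 / speed2 p1 p2).

Definition rescale w : phase :=
  let: (p1, p2, q1, q2) := w in
  (q1, q2, gauge p1 p2 *: vel1 p1 p2, gauge p1 p2 *: vel2 p1 p2).

Lemma kinetic0 : kinetic 0 0 = 0.
Proof. by rewrite -[X in kinetic X _](scale0r 0) -[X in kinetic _ X](scale0r 0)
  kineticZ expr0n mul0r. Qed.

Lemma gauge_speed2 p1 p2 : gauge p1 p2 ^+ 2 * speed2 p1 p2 = kinetic p1 p2.
Proof.
rewrite sqr_sqrtr ?divr_ge0 ?kinetic_ge0 ?speed2_ge0 //.
have [s0|s0] := eqVneq (speed2 p1 p2) 0; last by rewrite divfK.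
by have [-> ->] := speed2_eq0 s0; rewrite kinetic0 !mul0r.
Qed.

Lemma gauge_gt0 p1 p2 : kinetic p1 p2 != 0 -> 0 < gauge p1 p2.
Proof.
move=> k0; rewrite sqrtr_gt0 divr_gt0 // lt_neqAle eq_sym.
  by rewrite k0 kinetic_ge0.
rewrite speed2_ge0 andbT; apply: contra k0 => /eqP/speed2_eq0[-> ->].
by rewrite kinetic0.
Qed.

Lemma vel_inj p1 p2 p1' p2' :
  vel1 p1 p2 = vel1 p1' p2' -> vel2 p1 p2 = vel2 p1' p2' -> p1 = p1' /\ p2 = p2'.
Proof.
move=> v1 v2; rewrite (legendre1 p1 p2 m1n m2n l1n l2n).
rewrite [in p2 = _](legendre2 p1 p2 m1n m2n l1n l2n).
by rewrite v1 v2 -legendre1 // -legendre2.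
Qed.

Lemma vel_surj (u1 u2 : 'rV[R]_3) : exists p1 p2, vel1 p1 p2 = u1 /\ vel2 p1 p2 = u2.
Proof.
exists ((m1 * l1 ^+ 2) *: u1 + (m2 * l1) *: (l1 *: u1 + l2 *: u2)).
exists ((m2 * l2) *: (l1 *: u1 + l2 *: u2)).
by split; apply/rowP => i; rewrite !mxE; field; rewrite ?m1n ?m2n ?l1n ?l2n.
Qed.

Section Continuity.
Variables (T : topologicalType) (x : T) (p1 p2 : T -> 'rV[R]_3).
Hypotheses (c1 : cont_at x p1) (c2 : cont_at x p2).

Lemma cont_at_vel1 : cont_at x (fun t => vel1 (p1 t) (p2 t)).
Proof.
apply: cont_at_scalev; first exact: cont_at_cst.
apply: cont_at_addv; [|apply: cont_at_oppv]; apply: cont_at_scalev => //;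
  exact: cont_at_cst.
Qed.

Lemma cont_at_vel2 : cont_at x (fun t => vel2 (p1 t) (p2 t)).
Proof.
apply: cont_at_scalev; first exact: cont_at_cst.
apply: cont_at_addv; [apply: cont_at_addv; [|apply: cont_at_oppv]|];
  apply: cont_at_scalev => //; exact: cont_at_cst.
Qed.

Lemma cont_at_kinetic : cont_at x (fun t => kinetic (p1 t) (p2 t)).
Proof.
have cb : cont_at x (fun t => l2^-1 *: p2 t).
  by apply: cont_at_scalev => //; exact: cont_at_cst.
have ca : cont_at x (fun t => relative_momentum (p1 t) (p2 t)).
  apply: cont_at_addv; last exact: cont_at_oppv.
  by apply: cont_at_scalev => //; exact: cont_at_cst.
by rewrite /kinetic; cont.
Qed.

Lemma cont_at_speed2 : cont_at x (fun t => speed2 (p1 t) (p2 t)).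
Proof. by have := cont_at_vel1; have := cont_at_vel2 => ? ?; rewrite /speed2; cont. Qed.

(** At zero momentum the quotient in [gauge] depends on the direction of approach, but the product
    with [v] is bounded entrywise by the square root of the kinetic energy, which tends to 0. *)
Lemma cont_at_gauge (v : T -> 'rV[R]_3) : cont_at x v ->
  (forall t, dot (v t) (v t) <= speed2 (p1 t) (p2 t)) ->
  cont_at x (fun t => gauge (p1 t) (p2 t) *: v t).
Proof.
move=> cv vs; have ck := cont_at_kinetic; have cs := cont_at_speed2.
have [s0|s0] := eqVneq (speed2 (p1 x) (p2 x)) 0; last first.
  by apply: cont_at_scalev => //; rewrite /gauge; cont.
have [p10 p20] := speed2_eq0 s0.
apply: cont_at_row => k _.
apply: (@cont_at_squeeze0 _ _ _ _ (fun t => Num.sqrt (kinetic (p1 t) (p2 t)))).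
- by rewrite entryZ /gauge s0 invr0 mulr0 sqrtr0 mul0r.
- by rewrite p10 p20 kinetic0 sqrtr0.
- move=> t; rewrite entryZ -sqrtr_sqr ler_wsqrtr // exprMn -gauge_speed2.
  by rewrite ler_wpM2l ?sqr_ge0 // (le_trans (entry_sqr_le_dot _ _)).
- by cont.
Qed.

End Continuity.

Lemma cont_at_phase w : [/\ cont_at w (fun w : phase => w.1.1.1),
  cont_at w (fun w : phase => w.1.1.2), cont_at w (fun w : phase => w.1.2)
  & cont_at w (fun w : phase => w.2)].
Proof.
have c1 := cont_at_fst (@cont_at_id _ w); have c2 := cont_at_fst c1.
split; [exact: (cont_at_fst c2)|exact: (cont_at_snd c2)|exact: (cont_at_snd c1)|].
exact: (cont_at_snd (@cont_at_id _ w)).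
Qed.

Lemma cont_at_rescale w : cont_at w rescale.
Proof.
have [c1 c2 c3 c4] := cont_at_phase w.
have E : rescale = fun w => (w.1.2, w.2,
    gauge w.1.1.1 w.1.1.2 *: vel1 w.1.1.1 w.1.1.2,
    gauge w.1.1.1 w.1.1.2 *: vel2 w.1.1.1 w.1.1.2).
  by apply/funext => -[[[? ?] ?] ?].
rewrite E.
apply: (cont_at_pair (cont_at_pair (cont_at_pair c3 c4) _) _).
  apply: (cont_at_gauge c1 c2 (cont_at_vel1 c1 c2)) => t.
  by rewrite lerDl dot_ge0.
apply: (cont_at_gauge c1 c2 (cont_at_vel2 c1 c2)) => t.
by rewrite lerDr dot_ge0.
Qed.

Variables (h al1 al2 be : R).
Hypotheses (al1_ge0 : 0 <= al1) (al2_ge0 : 0 <= al2).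
Hypothesis hE : forall q1 q2 : 'rV[R]_3, h - potential m1 m2 l1 l2 g q1 q2
  = al1 * (1 - entry q1 2) + al2 * (1 - entry q2 2) - be.

Local Notation surface := (energy_surface m1 m2 l1 l2 g h).

Lemma surfaceP w : surface w <->
  let: (p1, p2, q1, q2) := w in
  [/\ dot q1 q1 = 1, dot q2 q2 = 1, dot q1 (vel1 p1 p2) = 0,
      dot q2 (vel2 p1 p2) = 0 &
      kinetic p1 p2 = al1 * (1 - entry q1 2) + al2 * (1 - entry q2 2) - be].
Proof.
case: w => [[[p1 p2] q1] q2]; rewrite -hE /energy_surface /=.
rewrite -/(relative_momentum p1 p2) -/(kinetic p1 p2).
split=> [[[a b c d] <-]|[a b c d ->]]; first by split=> //; rewrite addrK.
by split=> //; rewrite subrK.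
Qed.

Lemma dotZr n (c : R) (u v : 'rV[R]_n) : dot u (c *: v) = c * dot u v.
Proof.
by rewrite /dot mulr_sumr; apply: eq_bigr => i _; rewrite mxE mulrCA.
Qed.

Lemma rescale_model w : surface w -> model al1 al2 be (rescale w).
Proof.
case: w => [[[p1 p2] q1] q2] /surfaceP[a b c d k]; split=> /=.
  by split=> //=; [rewrite dotZr c mulr0|rewrite dotZr d mulr0].
rewrite (dotZ _ (vel1 p1 p2)) (dotZ _ (vel2 p1 p2)) -mulrDr.
by rewrite -[_ + _]/(speed2 p1 p2) gauge_speed2.
Qed.

(** The base point fixes the kinetic energy. Equal rescaled velocities mean equal momenta multiplied
    by the gauges, and comparing kinetic energies makes the gauges equal. *)
Lemma rescale_inj w w' : surface w -> surface w' -> rescale w = rescale w' -> w = w'.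
Proof.
case: w => [[[p1 p2] q1] q2] /surfaceP[_ _ _ _ k].
case: w' => [[[p1' p2'] q1'] q2'] /surfaceP[_ _ _ _ k'].
move=> [q11 q22 v1 v2]; rewrite -q11 -q22 in k' *.
have kk : kinetic p1' p2' = kinetic p1 p2 by rewrite k k'.
suff [-> ->] : p1 = p1' /\ p2 = p2' by [].
have [k0|k0] := eqVneq (kinetic p1 p2) 0.
  have [-> ->] := kinetic_eq0 k0.
  by rewrite k0 in kk; have [-> ->] := kinetic_eq0 kk.
have g0 := gauge_gt0 k0; have g0' : 0 < gauge p1' p2' by apply: gauge_gt0; rewrite kk.
move: v1 v2; rewrite -!vel1Z -!vel2Z => v1 v2.
have [e1 e2] := vel_inj v1 v2.
have gg : gauge p1 p2 = gauge p1' p2'.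
  have : kinetic (gauge p1 p2 *: p1) (gauge p1 p2 *: p2) =
    kinetic (gauge p1' p2' *: p1') (gauge p1' p2' *: p2') by rewrite e1 e2.
  rewrite !kineticZ kk => /(mulIf k0) /eqP.
  by rewrite eqrXn2 ?ltW // => /eqP.
rewrite -gg in e1 e2; have gn := lt0r_neq0 g0.
by split; [move: e1|move: e2] => /(scalerI gn).
Qed.

Lemma rescale_surj m : model al1 al2 be m -> exists2 w, surface w & rescale w = m.
Proof.
case: m => [[[q1 q2] u1] u2] [[/= a b c d] E].
have [p1 [p2 [v1 v2]]] := vel_surj u1 u2.
have S : speed2 p1 p2 = dot u1 u1 + dot u2 u2 by rewrite /speed2 v1 v2.
(* At zero speed [gauge] is 0 by the convention on inverses, which is harmless as the velocities
   vanish. *)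
have [s0|s0] := eqVneq (speed2 p1 p2) 0.
  have [p10 p20] := speed2_eq0 s0.
  exists (p1, p2, q1, q2).
    apply/surfaceP; rewrite v1 v2; split=> //.
    by rewrite -E -S s0 p10 p20 kinetic0.
  rewrite /rescale v1 v2 /gauge s0 invr0 mulr0 sqrtr0 !scale0r.
  move: v1 v2; rewrite p10 p20 -[X in velocity1 _ _ _ X _](scale0r 0).
  rewrite -[X in velocity1 _ _ _ _ X](scale0r 0) vel1Z scale0r => <-.
  rewrite -[X in velocity2 _ _ _ _ X _](scale0r 0).
  by rewrite -[X in velocity2 _ _ _ _ _ X](scale0r 0) vel2Z scale0r => <-.
have sp : 0 < speed2 p1 p2 by rewrite lt_neqAle eq_sym s0 speed2_ge0.
have kp : 0 < kinetic p1 p2.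
  rewrite lt_neqAle eq_sym kinetic_ge0 andbT;
    apply: contra s0 => /eqP/kinetic_eq0[-> ->].
  rewrite -[X in speed2 X _](scale0r 0) -[X in speed2 _ X](scale0r 0) speed2Z.
  by rewrite expr0n mul0r.
(* The factor for which the kinetic energy of [t *: p] is [speed2] of [p]; the gauge there is
   [t^-1]. *)
pose t := Num.sqrt (speed2 p1 p2 / kinetic p1 p2).
have t0 : 0 < t by rewrite sqrtr_gt0 divr_gt0.
have tt : t ^+ 2 = speed2 p1 p2 / kinetic p1 p2 by rewrite sqr_sqrtr // ltW // divr_gt0.
have kE : kinetic (t *: p1) (t *: p2) = speed2 p1 p2.
  by rewrite kineticZ tt divfK // gt_eqF.
have gE : gauge (t *: p1) (t *: p2) = t^-1.
  rewrite /gauge kE speed2Z invfM mulrCA divff // mulr1 -exprVn sqrtr_sqr.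
  by rewrite gtr0_norm // invr_gt0.
exists (t *: p1, t *: p2, q1, q2).
  apply/surfaceP; rewrite vel1Z vel2Z v1 v2 !dotZr c d mulr0 kE S E.
  by split.
by rewrite /rescale gE vel1Z vel2Z v1 v2 !scalerA mulVf ?scale1r // gt_eqF.
Qed.

Lemma surface_closed : closed surface.
Proof.
have eq_closed (f : phase -> R) c : (forall w, cont_at w f) -> closed [set w | f w = c].
  move=> cf; apply: (@preimage_closed _ _ f [set c]); first by move=> w _; exact: cf.
  exact: accessible_closed_set1 (hausdorff_accessible (@Rhausdorff R)) c.
pose k w := kinetic w.1.1.1 w.1.1.2
  - (al1 * (1 - entry w.1.2 2) + al2 * (1 - entry w.2 2) - be).
have -> : surface = [set w | dot w.1.2 w.1.2 = 1] `&` [set w | dot w.2 w.2 = 1]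
  `&` [set w | dot w.1.2 (vel1 w.1.1.1 w.1.1.2) = 0]
  `&` [set w | dot w.2 (vel2 w.1.1.1 w.1.1.2) = 0] `&` [set w | k w = 0].
  apply/seteqP; split; move=> -[[[p1 p2] q1] q2] /=.
    by move=> /surfaceP[a b c d E]; rewrite /k /= E subrr.
  move=> [[[[a b] c] d] /eqP E]; apply/surfaceP; split=> //.
  by apply/eqP; rewrite -subr_eq0.
have H w := cont_at_phase w.
repeat apply: closedI; apply: eq_closed => w; have [c1 c2 c3 c4] := H w.
- exact: (cont_at_dot c3 c3).
- exact: (cont_at_dot c4 c4).
- exact: (cont_at_dot c3 (cont_at_vel1 c1 c2)).
- exact: (cont_at_dot c4 (cont_at_vel2 c1 c2)).
- apply: cont_atD; first exact: (cont_at_kinetic c1 c2).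
  have z1 := cont_at_entry (k := 2%N) c3; have z2 := cont_at_entry (k := 2%N) c4.
  by cont.
Qed.

(** On the spheres the potential is bounded below, so the kinetic energy, a definite form in the
    momenta, is bounded above. *)
Lemma surface_compact : compact surface.
Proof.
(* The value of the right side with both q_i at the south pole, its maximum. *)
pose C := 2 * al1 + 2 * al2 - be.
pose B1 := Num.sqrt (2 * m1 * C); pose B2 := Num.sqrt (2 * m2 * C).
(* [B1] bounds the relative momentum and [B2] the vector p2 / l2; the summand 1 covers the entries
   of q1 and q2. *)
pose B := l1 * (B1 + B2) + l2 * B2 + 1.
pose K := [set v : 'rV[R]_3 | forall k, `|entry v k| <= B].
have cK : compact K by exact: compact_box.
apply: (subclosed_compact surface_closed
  (compact_setX (compact_setX (compact_setX cK cK) cK) cK)).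
move=> [[[p1 p2] q1] q2] /surfaceP[a b _ _ E].
have [/andP[z1 z1'] /andP[z2 z2']] := (unit_z_bounds a, unit_z_bounds b).
have kC : kinetic p1 p2 <= C.
  have h1 : al1 * (1 - entry q1 2) <= al1 * 2 by rewrite ler_wpM2l //; lra.
  have h2 : al2 * (1 - entry q2 2) <= al2 * 2 by rewrite ler_wpM2l //; lra.
  by rewrite E /C; lra.
have le_sqrt (v : 'rV[R]_3) c k : dot v v <= c -> `|entry v k| <= Num.sqrt c.
  by move=> vc; rewrite -sqrtr_sqr ler_wsqrtr // (le_trans (entry_sqr_le_dot _ _)).
have B10 : 0 <= B1 := sqrtr_ge0 _; have B20 : 0 <= B2 := sqrtr_ge0 _.
have i1 : 0 < m1^-1 by rewrite invr_gt0.
have i2 : 0 < m2^-1 by rewrite invr_gt0.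
have d1 := dot_ge0 (relative_momentum p1 p2); have d2 := dot_ge0 (l2^-1 *: p2).
have e1 : 0 <= m1^-1 * dot (relative_momentum p1 p2) (relative_momentum p1 p2)
  by rewrite mulr_ge0 // ltW.
have e2 : 0 <= m2^-1 * dot (l2^-1 *: p2) (l2^-1 *: p2) by rewrite mulr_ge0 // ltW.
have kE : 2 * kinetic p1 p2 = m1^-1
  * dot (relative_momentum p1 p2) (relative_momentum p1 p2)
    + m2^-1 * dot (l2^-1 *: p2) (l2^-1 *: p2).
  by rewrite /kinetic mulrA divff ?mul1r.
have rb k : `|entry (relative_momentum p1 p2) k| <= B1.
  apply: le_sqrt; rewrite -mulrA mulrCA -ler_pdivrMl //.
  by lra.
have sb k : `|entry (l2^-1 *: p2) k| <= B2.
  apply: le_sqrt; rewrite -mulrA mulrCA -ler_pdivrMl //.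
  by lra.
have qb (q : 'rV[R]_3) k : dot q q = 1 -> `|entry q k| <= B.
  move=> q1'; have := le_sqrt q 1 k; rewrite q1' sqrtr1 lexx => /(_ isT) H.
  by rewrite (le_trans H) // lerDr addr_ge0 ?mulr_ge0 ?addr_ge0 // ltW.
have p2b k : `|entry p2 k| <= l2 * B2.
  have -> : entry p2 k = l2 * entry (l2^-1 *:
    p2) k by rewrite entryZ mulrA divff ?mul1r.
  by rewrite normrM gtr0_norm // (ler_wpM2l (ltW hl2)).
have p1b k : `|entry p1 k| <= l1 * (B1 + B2).
  have -> : entry p1 k = l1 * (entry (relative_momentum p1 p2) k + entry (l2^-1 *:
    p2) k).
    by rewrite /entry /relative_momentum !mxE subrK mulrA divff ?mul1r.
  rewrite normrM gtr0_norm // (ler_wpM2l (ltW hl1)) //.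
  by rewrite (le_trans (ler_normD _ _)) // lerD.
have lB2 : 0 <= l2 * B2 by rewrite mulr_ge0 // ltW.
have lB1 : 0 <= l1 * (B1 + B2) by rewrite mulr_ge0 ?addr_ge0 // ltW.
split; [split; [split|]|] => k /=.
- by rewrite (le_trans (p1b k)) // /B -addrA lerDl addr_ge0.
- by rewrite (le_trans (p2b k)) // /B addrAC lerDr addr_ge0.
- exact: qb.
- exact: qb.
Qed.

Lemma surface_connsum : admissible al1 al2 be ->
  homeomorphic_to_connsum R 7 (surface : topologicalType) (@S2xS5 R) (@S2xS5 R).
Proof.
move=> adm; apply: (@connsum_of_model _ al1 al2 be _ (fun x =>
  rescale (set_val x))) adm _ _ _ _ _.
- exact: compact_set_type surface_compact.
- move=> x; apply: (cont_at_comp (g := rescale)); last exact: cont_at_rescale.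
  by apply: cont_at_set_val; exact: cont_at_id.
- by move=> x y /rescale_inj xy; apply: val_inj; apply: xy; exact: set_valP.
- by move=> x; apply: rescale_model; exact: set_valP.
- move=> m /rescale_surj[w sw wm].
  by exists (exist (fun v => v \in surface) w (mem_set sw)).
Qed.

End EnergySurface.

(** * Energies just above H(P3) *)

Unset Implicit Arguments.

Theorem proposition3p5 (R : realType) (m1 m2 l1 l2 g : R)
    (hm1 : 0 < m1) (hm2 : 0 < m2) (hl1 : 0 < l1) (hl2 : 0 < l2) (hg : 0 < g)
    (hk : 1 < slope m1 m2 l1 l2) :
  \forall eps \near 0^'+,
    homeomorphic_to_connsum R 7
      (energy_surface m1 m2 l1 l2 g
         (hamiltonian m1 m2 l1 l2 g (P3 R) + eps) : topologicalType)
      (unit_sphere R 2 * unit_sphere R 5)%type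
      (unit_sphere R 2 * unit_sphere R 5)%type.
Proof.
set k := slope m1 m2 l1 l2 in hk; pose c := g * m2 * l2.
have c0 : 0 < c by rewrite !mulr_gt0.
have c2 : 0 < 2 * c by rewrite mulr_gt0.
have HP3 : hamiltonian m1 m2 l1 l2 g (P3 R) = c * (k - 1).
  have z1 : zcoord (north_pole R) = 1 by rewrite /zcoord /north_pole mxE !eqxx.
  have z2 : zcoord (south_pole R) = -1 by rewrite -z1 /zcoord /south_pole mxE.
  rewrite /hamiltonian /= !scaler0 subr0 /potential z1 z2 -/k -/c mulr1.
  have -> : dot (0 : 'rV[R]_3) 0 = 0.
    by rewrite /dot big1 // => i _; rewrite mxE mulr0.
  by rewrite !mulr0 addr0 mulr0 add0r.
near=> eps.
have e0 : 0 < eps by near: eps; exact: nbhs_right_gt.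
(* [2 * c] is H(P4) - H(P3), so the energy stays below the highest critical value. *)
have e2 : eps < 2 * c by near: eps; exact: nbhs_right_lt.
have ck : c < c * k by rewrite ltr_pMr.
have a1 : 0 <= c * k by rewrite ltW // (lt_trans c0).
(* [c * k] and [c] are the weights of the heights in the potential, and [2 * c - eps] is H(P4) minus
   the energy. It is below [2 * c] because eps > 0, and below [2 * (c * k)] because k > 1. *)
apply: (@surface_connsum R m1 m2 l1 l2 g hm1 hm2 hl1 hl2 _
  (c * k) c (2 * c - eps) a1 (ltW c0)).
- move=> q1 q2; rewrite HP3 /potential !zcoordE -/k -/c; ring.
- by split; lra.
Unshelve. all: by end_near. Qed.
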